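(* There exists a nonseparable Banach space $E$ which has the Schur property (every weakly convergent sequence in $E$ converges in norm) and such that the free Banach lattice $FBL[E]$ is not $\infty$-projective.
   Context: All Banach spaces and Banach lattices are real. A Banach lattice homomorphism is a bounded linear map preserving the lattice operations $\vee,\wedge$. For a real number $\lambda>1$, a Banach lattice $P$ is $\lambda$-projective if whenever $X$ is a Banach lattice, $J$ a closed (order) ideal in $X$ and $Q\colon X\to X/J$ the quotient map, then for every Banach lattice homomorphism $T\colon P\to X/J$ there is a Banach lattice homomorphism $\hat T\colon P\to X$ such that $T=Q\circ\hat T$ and $\|\hat T\|\le\lambda\|T\|$. $P$ is $\infty$-projective if it is $\lambda$-projective for some $\lambda>1$. For a Banach space $E$, the free Banach lattice generated by $E$, denoted $FBL[E]$, is a Banach lattice together with a bounded operator $u\colon E\to FBL[E]$ such that for every Banach lattice $Y$ and every bounded operator $T\colon E\to Y$ there is a unique Banach lattice homomorphism $S\colon FBL[E]\to Y$ with $S\circ u=T$ and $\|S\|=\|T\|$. It exists and is unique up to Banach lattice isometry. Concretely, for $f\colon E^*\to\mathbb{R}$ put $$\|f\|_{FBL[E]}=\sup\Big\{\sum_{i=1}^n|f(x_i^* )| : n\in\mathbb{N},\ x_1^*,\dots,x_n^*\in E^*,\ \sup_{x\in B_E}\sum_{i=1}^n|x_i^*(x)|\le 1\Big\},$$ where $B_E$ is the closed unit ball; $FBL[E]$ is the closure, with respect to this norm, of the vector lattice (with pointwise operations) generated by the evaluations $\delta_x\colon x^*\mapsto x^*(x)$, $x\in E$, among the positively homogeneous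 functions $E^*\to\mathbb{R}$ of finite norm, and $u(x)=\delta_x$. *)

(* Defs.v *)
From HB Require Import structures.
From mathcomp Require Import all_boot all_order all_algebra.
From mathcomp Require Import all_classical all_reals all_analysis.
Set Implicit Arguments.
Unset Strict Implicit.
Unset Printing Implicit Defensive.
Import GRing.Theory Num.Theory.
Import numFieldNormedType.Exports.
Local Open Scope classical_set_scope.
Local Open Scope ring_scope.

(* The order is carried by vle rather than by Order.Lattice: additive groups and
   ring-displayed lattices already meet in Num.RealDomain, so the hierarchy
   admits no further structure joining them. *)
HB.mixin Record isBanachLattice (R : realType) V & CompleteNormedModule R V := {
  vle : rel V ;
  vjoin : V -> V -> V ;
  vmeet : V -> V -> V ;
  vle_refl : reflexive vle ;
  vle_anti : antisymmetric vle ;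
  vle_trans : transitive vle ;
  vjoinP : forall x y z : V, vle (vjoin x y) z = vle x z && vle y z ;
  vmeetP : forall x y z : V, vle z (vmeet x y) = vle z x && vle z y ;
  vle_add2r : forall x y z : V, vle x y -> vle (x + z) (y + z) ;
  vle_scale_ge0 : forall (a : R) (x : V), 0 <= a -> vle 0 x -> vle 0 (a *: x) ;
  vle_norm : forall x y : V,
    vle (vjoin x (- x)) (vjoin y (- y)) -> `|x| <= `|y|
}.

#[short(type="banachLatticeType")]
HB.structure Definition BanachLattice (R : realType) :=
  {V of CompleteNormedModule R V & isBanachLattice R V}.

Definition modulus (R : realType) (X : banachLatticeType R) (x : X) : X :=
  vjoin x (- x).

Definition bounded_op (R : realType) (V W : normedModType R)
    (T : {linear V -> W}) : Prop :=
  exists M : R, forall x : V, `|T x| <= M * `|x|.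

(* Only meaningful for bounded operators: otherwise the set has no supremum
   and sup returns a default value. *)
Definition opnorm (R : realType) (V W : normedModType R)
    (T : {linear V -> W}) : R :=
  sup [set `|T x| | x in [set x : V | `|x| <= 1]].

Definition blat_hom (R : realType) (X Y : banachLatticeType R)
    (T : {linear X -> Y}) : Prop :=
  [/\ bounded_op T,
      forall x y : X, T (vjoin x y) = vjoin (T x) (T y) &
      forall x y : X, T (vmeet x y) = vmeet (T x) (T y)].

Definition closed_ideal (R : realType) (X : banachLatticeType R)
    (J : set X) : Prop :=
  [/\ closed J, J 0,
      forall (a : R) (x y : X), J x -> J y -> J (a *: x + y) &
      forall x y : X, J y -> vle (modulus x) (modulus y) -> J x].

(* Z, with the map Q, is the quotient Banach lattice X/J: as a vector lattice
   it is X modulo J, and its norm is the quotient norm, that is, the distance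
   to J.  This determines (Z, Q) up to a unique lattice isometry under X. *)
Definition quotient_map (R : realType) (X Z : banachLatticeType R)
    (J : set X) (Q : {linear X -> Z}) : Prop :=
  [/\ blat_hom Q,
      forall z : Z, exists x : X, Q x = z,
      forall x : X, Q x = 0 <-> J x &
      forall x : X, `|Q x| = inf [set `|x - j| | j in J]].

Definition projective (R : realType) (lambda : R)
    (P : banachLatticeType R) : Prop :=
  forall (X : banachLatticeType R) (J : set X), closed_ideal J ->
  forall (Z : banachLatticeType R) (Q : {linear X -> Z}), quotient_map J Q ->
  forall T : {linear P -> Z}, blat_hom T ->
  exists That : {linear P -> X},
    [/\ blat_hom That,
        forall p : P, T p = Q (That p) &
        opnorm That <= lambda * opnorm T].

Definition infty_projective (R : realType) (P : banachLatticeType R) : Prop :=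
  exists2 lambda : R, 1 < lambda & projective lambda P.

Definition FBL_extension (R : realType) (E : completeNormedModType R)
    (F Y : banachLatticeType R) (u : {linear E -> F}) (T : {linear E -> Y})
    (S : {linear F -> Y}) : Prop :=
  [/\ blat_hom S, forall x : E, S (u x) = T x & opnorm S = opnorm T].

(* (F, u) is the free Banach lattice FBL[E] with its canonical map: this
   universal property determines it up to Banach lattice isometry. *)
Definition is_FBL (R : realType) (E : completeNormedModType R)
    (F : banachLatticeType R) (u : {linear E -> F}) : Prop :=
  bounded_op u /\
  forall (Y : banachLatticeType R) (T : {linear E -> Y}), bounded_op T ->
  exists2 S : {linear F -> Y}, FBL_extension u T S &
    forall S' : {linear F -> Y}, FBL_extension u T S' -> S' =1 S.

Definition separable (T : topologicalType) : Prop :=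
  exists2 D : set T, countable D & dense D.

Definition weakly_cvg (R : realType) (E : normedModType R)
    (x : nat -> E) (l : E) : Prop :=
  forall f : {linear E -> R^o}, bounded_op f ->
    f (x n) @[n --> \oo] --> f l.

Definition schur_property (R : realType) (E : normedModType R) : Prop :=
  forall (x : nat -> E) (l : E), weakly_cvg x l -> x n @[n --> \oo] --> l.

(* Main.v *)
Require Import Defs.
From HB Require Import structures.
From mathcomp Require Import all_boot all_order all_algebra.
From mathcomp Require Import all_classical all_reals all_analysis.
From mathcomp Require Import ring lra.
Set Implicit Arguments.
Unset Strict Implicit.
Unset Printing Implicit Defensive.
Import Order.TTheory GRing.Theory Num.Theory.
Import numFieldNormedType.Exports.
Local Open Scope classical_set_scope.
Local Open Scope ring_scope.

(** Let [G] be the set of branches of the binary tree and [E_n] the space [l_1(G)]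
    with the norm [|x|_oo + |x|_1 / (n+1)]; take for [E] the [l_1]-sum of the [E_n].
    Each [E_n] is isomorphic to [l_1(G)], and a gliding hump shows that [E] has
    the Schur property.

    Let [X] consist of the families indexed by the nodes and the branches of the
    tree that converge along every branch to their value there, these values
    being in [c_0(G)].  Restriction to the branches makes [c_0(G)] a quotient of
    [X].  If [FBL[E]] were lambda-projective, the operator reading off the [n]-th
    block would lift to an operator [E -> X] of norm at most [lambda].  The lift
    of a unit vector [e_g] is then at least [1/2] at some node below [g]; there
    are only countably many nodes, so some node serves [n+1] branches.  The sum
    of the corresponding [e_g] has norm at most [2], while its lift is at least
    [(n+1)/2] at that node, which is absurd for large [n].

    [FBL[E]] itself is the closed sublattice generated by [E] in the [l_oo]-product
    of enough Banach lattices [Y_i], each with a contraction [E -> Y_i]. *)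

(** * Spaces normed by a family of seminorms *)

(* A norm given as the supremum of a family of seminorms [sd_semi].  By
   [sd_semi_fin] a seminorm depends on finitely many coordinates, so that it passes
   to pointwise limits; by [sd_semi_ev] norm convergence implies pointwise
   convergence. *)
Record sup_data (R : realType) := SupData {
  sd_idx : Type;
  sd_fib : sd_idx -> completeNormedModType R;
  sd_tst : Type;
  sd_semi : sd_tst -> (forall i, sd_fib i) -> R;
  sd_mem : (forall i, sd_fib i) -> Prop;
  sd_semiD : forall k f g, sd_semi k (fun i => f i + g i) <= sd_semi k f + sd_semi k g;
  sd_semiZ : forall k a f, sd_semi k (fun i => a *: f i) = `|a| * sd_semi k f;
  sd_semi_fin : forall k, exists s : seq sd_idx,
    forall f, sd_semi k f <= \sum_(i <- s) `|f i|;
  sd_semi_ev : forall i, exists k, forall f, `|f i| <= sd_semi k f;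
  sd_mem0 : sd_mem (fun i => 0);
  sd_memD : forall f g, sd_mem f -> sd_mem g -> sd_mem (fun i => f i + g i);
  sd_memZ : forall a f, sd_mem f -> sd_mem (fun i => a *: f i);
  sd_bounded : forall f, sd_mem f -> exists M, forall k, sd_semi k f <= M;
  sd_closed : forall f,
    (forall e, 0 < e -> exists2 g, sd_mem g & forall k, sd_semi k (fun i => f i - g i) <= e) ->
    sd_mem f
}.

Definition sup_space (R : realType) (D : sup_data R) :=
  {f : forall i : sd_idx D, sd_fib i | sd_mem f}.

Section SupSpace.
Variables (R : realType) (D : sup_data R).
Local Notation T := (sup_space D).
Implicit Types x y z : T.

Definition scoord x (i : sd_idx D) : sd_fib i := sval x i.

HB.instance Definition _ := gen_eqMixin T.
HB.instance Definition _ := gen_choiceMixin T.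

Lemma sup_space_eq x y : (forall i, scoord x i = scoord y i) -> x = y.
Proof.
move=> xy; have : sval x = sval y by apply: functional_extensionality_dep => i; exact: xy.
by case: x y {xy} => [f Df] [g Dg] /= fg; subst g; congr exist.
Qed.

Let sopp_mem x : sd_mem (fun i => - scoord x i).
Proof.
rewrite (_ : (fun i => _) = (fun i => (-1) *: scoord x i)).
  by apply: sd_memZ; exact: (svalP x).
by apply: functional_extensionality_dep => i; rewrite scaleN1r.
Qed.

Definition szero : T := exist _ _ (sd_mem0 D).
Definition sopp x : T := exist _ _ (sopp_mem x).
Definition sadd x y : T := exist _ _ (sd_memD (svalP x) (svalP y)).
Definition sscale (a : R) x : T := exist _ _ (sd_memZ a (svalP x)).

Let saddA : associative sadd.
Proof. by move=> x y z; apply: sup_space_eq => i; rewrite /scoord /= addrA. Qed.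
Let saddC : commutative sadd.
Proof. by move=> x y; apply: sup_space_eq => i; rewrite /scoord /= addrC. Qed.
Let sadd0 : left_id szero sadd.
Proof. by move=> x; apply: sup_space_eq => i; rewrite /scoord /= add0r. Qed.
Let saddN : left_inverse szero sopp sadd.
Proof. by move=> x; apply: sup_space_eq => i; rewrite /scoord /= addNr. Qed.

HB.instance Definition _ := GRing.isZmodule.Build T saddA saddC sadd0 saddN.

Lemma scoord0 i : scoord 0 i = 0. Proof. by []. Qed.
Lemma scoordD x y i : scoord (x + y) i = scoord x i + scoord y i. Proof. by []. Qed.
Lemma scoordN x i : scoord (- x) i = - scoord x i. Proof. by []. Qed.

Let sscaleA (a b : R) x : sscale a (sscale b x) = sscale (a * b) x.
Proof. by apply: sup_space_eq => i; rewrite /scoord /= scalerA. Qed.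
Let sscale1 : left_id 1 sscale.
Proof. by move=> x; apply: sup_space_eq => i; rewrite /scoord /= scale1r. Qed.
Let sscaleDr : right_distributive sscale +%R.
Proof. by move=> a x y; apply: sup_space_eq => i; rewrite /scoord /= scalerDr. Qed.
Let sscaleDl x : {morph sscale^~ x : a b / a + b}.
Proof. by move=> a b; apply: sup_space_eq => i; rewrite /scoord /= scalerDl. Qed.

HB.instance Definition _ :=
  GRing.Zmodule_isLmodule.Build R T sscaleA sscale1 sscaleDr sscaleDl.

(* [0] is thrown in to keep the set nonempty when [sd_tst D] is empty. *)
Definition svals x : set R := [set r | r = 0 \/ exists k, r = sd_semi k (scoord x)].
Definition snorm x : R := sup (svals x).

Lemma svals_ubound x : has_ubound (svals x).
Proof.
have [M HM] := sd_bounded (svalP x).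
exists `|M| => r [->|[k ->]]; first exact: normr_ge0.
exact: le_trans (HM k) (ler_norm _).
Qed.

Lemma snorm_le x M : 0 <= M -> (forall k, sd_semi k (scoord x) <= M) -> snorm x <= M.
Proof.
move=> M0 HM; apply: ge_sup; first by exists 0; left.
by move=> r [->|[k ->]].
Qed.

Lemma semi_le_snorm k x : sd_semi k (scoord x) <= snorm x.
Proof. by apply: ub_le_sup; [exact: svals_ubound|right; exists k]. Qed.

Lemma snorm_ge0 x : 0 <= snorm x.
Proof. by apply: ub_le_sup; [exact: svals_ubound|left]. Qed.

Let snormD x y : snorm (x + y) <= snorm x + snorm y.
Proof.
apply: snorm_le => [|k]; first by rewrite addr_ge0 ?snorm_ge0.
by apply: (le_trans (sd_semiD _ _ _)); rewrite lerD ?semi_le_snorm.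
Qed.

Let snormZ (a : R) x : snorm (a *: x) = `|a| * snorm x.
Proof.
have H b y : snorm (b *: y) <= `|b| * snorm y.
  apply: snorm_le => [|k]; first by rewrite mulr_ge0 ?snorm_ge0.
  by rewrite sd_semiZ ler_wpM2l ?semi_le_snorm.
apply/le_anti; rewrite H /=.
have [->|a0] := eqVneq a 0; first by rewrite normr0 mul0r snorm_ge0.
have := H a^-1 (a *: x); rewrite scalerA mulVf// scale1r normfV.
by rewrite -ler_pdivrMl ?invr_gt0 ?normr_gt0// invrK.
Qed.

Lemma scoord_le_snorm x i : `|scoord x i| <= snorm x.
Proof. by have [k Hk] := sd_semi_ev i; exact: le_trans (Hk _) (semi_le_snorm _ _). Qed.

Let snorm0_eq0 x : snorm x = 0 -> x = 0.
Proof.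
move=> x0; apply: sup_space_eq => i; apply/eqP; rewrite scoord0 -normr_le0 -x0.
exact: scoord_le_snorm.
Qed.

HB.instance Definition _ := Lmodule_isNormed.Build R T snormD snormZ snorm0_eq0.

Lemma sup_norm_le x M : 0 <= M -> (forall k, sd_semi k (scoord x) <= M) -> `|x| <= M.
Proof. exact: snorm_le. Qed.

Lemma semi_le_norm k x : sd_semi k (scoord x) <= `|x|.
Proof. exact: semi_le_snorm. Qed.

Lemma norm_scoord_le x i : `|scoord x i| <= `|x|.
Proof. exact: scoord_le_snorm. Qed.

(** Coordinates converge because the fibres are complete. A Cauchy estimate holds for all seminorms
    at once, and it passes to the coordinatewise limit because each seminorm is dominated by
    finitely many coordinates. *)
Lemma sup_space_complete (F : set_system T) : ProperFilter F -> cauchy F -> cvg F.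
Proof.
move=> FF Fc.
have Fcau (e : R) : 0 < e -> exists2 A : set T, F A & forall x y, A x -> A y -> `|x - y| <= e.
  move=> e0; have /cauchy_ballP/(_ _ e0) := Fc.
  move=> [[A B] /= [FA FB] AB].
  exists (A `&` B); first exact: filterI.
  by move=> x y [Ax _] [_ By]; have := AB (x, y) (conj Ax By); rewrite -ball_normE /= => /ltW.
have Fi i : cvg ((scoord^~ i) @ F).
  apply: cauchy_cvg; apply/cauchy_ballP => e e0.
  have e20 : 0 < e / 2 by rewrite divr_gt0.
  have [A FA HA] := Fcau _ e20.
  exists ((scoord^~ i) @` A, (scoord^~ i) @` A).
    by split; apply: (@filterS _ F _ A _ _ FA) => x Ax; exists x.
  move=> [_ _] [/= [x Ax <-] [y Ay <-]]; rewrite -ball_normE /=.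
  rewrite -scoordN -scoordD; apply: le_lt_trans (norm_scoord_le _ _) _.
  by apply: le_lt_trans (HA _ _ Ax Ay) _; rewrite ltr_pdivrMr// ltr_pMr// ltr1n.
pose f i := lim ((scoord^~ i) @ F).
have fP (e : R) : 0 < e -> exists2 A : set T, F A &
    forall x, A x -> forall k, sd_semi k (fun i => f i - scoord x i) <= e.
  (* The slack [d] pays for the finitely many coordinates controlling the seminorm [k]: some [y] in
     [A], depending on [k] and [d], is that close to [f] there, while [x] and [y] differ by at most
     [e]. *)
  move=> e0; have [A FA HA] := Fcau _ e0.
  exists A => // x Ax k; apply/ler_addgt0Pr => d d0.
  have [s Hs] := sd_semi_fin k.
  have : \forall y \near F, A y /\ \sum_(i <- s) `|f i - scoord y i| <= d.
    apply: filterI => //.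
    elim: s d d0 {Hs} => [|i s IH] d d0.
      by apply: nearW => y; rewrite big_nil ltW.
    have d20 : 0 < d / 2 by rewrite divr_gt0.
    have := IH _ d20.
    have /cvgrPdist_le/(_ _ d20) := Fi i.
    move=> H1 H2; apply: filterS2 H1 H2 => y /= H1 H2.
    by rewrite big_cons [d]splitr lerD.
  move=> /filter_ex [y [Ay yd]].
  have -> : (fun i => f i - scoord x i) =
      (fun i => (f i - scoord y i) + scoord (y - x) i).
    by apply: functional_extensionality_dep => i; rewrite scoordD scoordN addrA subrK.
  apply: le_trans (sd_semiD _ _ _) _; rewrite addrC lerD//.
    by apply: le_trans (semi_le_norm _ _) _; exact: HA.
  exact: le_trans (Hs _) _.
have Df : sd_mem f.
  apply: sd_closed => e e0; have [A FA HA] := fP _ e0.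
  have [x Ax] := filter_ex FA.
  by exists (scoord x); [exact: (svalP x)|exact: HA].
apply/cvg_ex; exists (exist _ f Df : T); apply/cvgrPdist_le => e e0.
have [A FA HA] := fP _ e0; apply: filterS FA => x Ax.
apply: sup_norm_le; first exact: ltW.
exact: HA.
Qed.

HB.instance Definition _ := Uniform_isComplete.Build T sup_space_complete.

End SupSpace.

Arguments scoord : simpl never.

(** * Banach lattices *)

Arguments vle_trans {R s} [y x z] _ _.
Arguments vle_add2r {R s} [x y] z _.
Arguments vle_scale_ge0 {R s} [a x] _ _.
Arguments vle_norm {R s} [x y] _.
Arguments vle_anti {R s} [x y] _.

(** * Elementary inequalities in Banach lattices *)

Section VectorLattice.
Variables (R : realType) (X : banachLatticeType R).
Implicit Types x y z a b c d : X.

Lemma vle_joinl x y : vle x (vjoin x y).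
Proof. by have := vle_refl (vjoin x y); rewrite vjoinP => /andP[]. Qed.

Lemma vle_joinr x y : vle y (vjoin x y).
Proof. by have := vle_refl (vjoin x y); rewrite vjoinP => /andP[]. Qed.

Lemma vle_meetl x y : vle (vmeet x y) x.
Proof. by have := vle_refl (vmeet x y); rewrite vmeetP => /andP[]. Qed.

Lemma vle_meetr x y : vle (vmeet x y) y.
Proof. by have := vle_refl (vmeet x y); rewrite vmeetP => /andP[]. Qed.

Lemma vleD x y a b : vle x y -> vle a b -> vle (x + a) (y + b).
Proof.
move=> xy ab; apply: (vle_trans (vle_add2r a xy)).
by rewrite ![y + _]addrC; exact: vle_add2r.
Qed.

Lemma vle_subr x y z : vle (x - y) z = vle x (z + y).
Proof.
apply/idP/idP => [/(vle_add2r y)|/(vle_add2r (- y))]; first by rewrite subrK.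
by rewrite addrK.
Qed.

Lemma vleN x y : vle (- x) (- y) = vle y x.
Proof. by rewrite -[- x]add0r vle_subr addrC -vle_subr opprK add0r. Qed.

Lemma vmeetE x y : vmeet x y = - vjoin (- x) (- y).
Proof.
apply: vle_anti; apply/andP; split.
  by rewrite -vleN opprK vjoinP !vleN vle_meetl vle_meetr.
by rewrite vmeetP -[vle _ x]vleN -[vle _ y]vleN opprK vle_joinl vle_joinr.
Qed.

(** The modulus dominates both [x] and [- x], so its double dominates their sum [0]. *)
Lemma modulus_ge0 x : vle 0 (modulus x).
Proof.
have H : vle 0 (modulus x + modulus x).
  by rewrite -(subrr x); apply: vleD; [exact: vle_joinl|exact: vle_joinr].
have h2 : (0 : R) <= 2^-1 by rewrite invr_ge0.
have := vle_scale_ge0 h2 H.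
by rewrite -mulr2n -(scaler_nat 2 (modulus x)) scalerA mulVf ?scale1r// pnatr_eq0.
Qed.

Lemma ger0_modulus x : vle 0 x -> modulus x = x.
Proof.
move=> x0; apply: vle_anti; rewrite /modulus vle_joinl andbT vjoinP vle_refl /=.
by apply: (vle_trans _ x0); rewrite -vleN oppr0 opprK.
Qed.

Lemma norm_modulus x : `|modulus x| = `|x|.
Proof.
have H := ger0_modulus (modulus_ge0 x).
by apply/le_anti/andP; split; apply: vle_norm; rewrite -!/(modulus _) H vle_refl.
Qed.

Lemma vle_norm_ge0 x y : vle x y -> vle (- x) y -> `|x| <= `|y|.
Proof.
move=> xy nxy; apply: vle_norm; rewrite vjoinP; apply/andP; split.
  exact: vle_trans xy (vle_joinl _ _).
exact: vle_trans nxy (vle_joinl _ _).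
Qed.

Lemma vjoin_sub_modulus a b c d :
  vle (vjoin a b - vjoin c d) (modulus (a - c) + modulus (b - d)).
Proof.
rewrite vle_subr vjoinP; apply/andP; split.
- rewrite [X in vle X _](_ : a = (a - c) + 0 + c); last by rewrite addr0 subrK.
  apply: vleD; last exact: vle_joinl.
  by apply: vleD; [exact: vle_joinl|exact: modulus_ge0].
- rewrite [X in vle X _](_ : b = 0 + (b - d) + d); last by rewrite add0r subrK.
  apply: vleD; last exact: vle_joinr.
  by apply: vleD; [exact: modulus_ge0|exact: vle_joinl].
Qed.

Lemma modulusN x : modulus (- x) = modulus x.
Proof.
rewrite /modulus opprK; apply: vle_anti.
by rewrite !vjoinP !vle_joinl !vle_joinr.
Qed.

(** Continuity of the join: it lets lattice identities pass from dense sets to limits. *)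
Lemma norm_vjoin_sub a b c d : `|vjoin a b - vjoin c d| <= `|a - c| + `|b - d|.
Proof.
rewrite -(norm_modulus (a - c)) -(norm_modulus (b - d)).
apply: le_trans (ler_normD _ _); apply: vle_norm_ge0; first exact: vjoin_sub_modulus.
by rewrite opprB -(modulusN (a - c)) -(modulusN (b - d)) !opprB; exact: vjoin_sub_modulus.
Qed.

Lemma norm_vjoin_le a b : `|vjoin a b| <= `|a| + `|b|.
Proof.
have := norm_vjoin_sub a b 0 0; rewrite !subr0.
suff -> : vjoin 0 0 = 0 :> X by rewrite subr0.
by apply: vle_anti; rewrite vjoinP !vle_refl vle_joinl.
Qed.

End VectorLattice.

(** * The real line as a Banach lattice *)

Section RealLattice.
Variable R : realType.

Let rle : rel R^o := fun x y => (x <= y :> R).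
Let rjoin (x y : R^o) : R^o := Num.max (x : R) y.
Let rmeet (x y : R^o) : R^o := Num.min (x : R) y.

Let rle_refl : reflexive rle. Proof. exact: (@lexx _ R). Qed.
Let rle_anti : antisymmetric rle. Proof. exact: (@le_anti _ R). Qed.
Let rle_trans : transitive rle. Proof. exact: (@le_trans _ R). Qed.
Let rjoinP x y z : rle (rjoin x y) z = rle x z && rle y z.
Proof. exact: (@ge_max _ R). Qed.
Let rmeetP x y z : rle z (rmeet x y) = rle z x && rle z y.
Proof. exact: (@le_min _ R). Qed.
Let rle_add x y z : rle x y -> rle (x + z) (y + z).
Proof. by rewrite /rle => xy; rewrite (@lerD2r R). Qed.
Let rle_scale (a : R) x : 0 <= a -> rle 0 x -> rle 0 (a *: x).
Proof. exact: (@mulr_ge0 R). Qed.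
Let rle_norm x y : rle (rjoin x (- x)) (rjoin y (- y)) -> `|x| <= `|y|.
Proof. by rewrite /rle /rjoin !(@maxrN R). Qed.

HB.instance Definition _ := isBanachLattice.Build R R^o rle_refl rle_anti
  rle_trans rjoinP rmeetP rle_add rle_scale rle_norm.

End RealLattice.

(** A closed vector sublattice of an [l_oo]-product of Banach lattices. Closure under meets follows
    from joins and negation, see [ld_memM]. *)
Record lat_data (R : realType) := LatData {
  ld_idx : Type;
  ld_fib : ld_idx -> banachLatticeType R;
  ld_mem : (forall i, ld_fib i) -> Prop;
  ld_mem0 : ld_mem (fun i => 0);
  ld_memD : forall f g, ld_mem f -> ld_mem g -> ld_mem (fun i => f i + g i);
  ld_memZ : forall a f, ld_mem f -> ld_mem (fun i => a *: f i);
  ld_memJ : forall f g, ld_mem f -> ld_mem g -> ld_mem (fun i => vjoin (f i) (g i));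
  ld_bounded : forall f, ld_mem f -> exists M, forall i, `|f i| <= M;
  ld_closed : forall f,
    (forall e, 0 < e -> exists2 g, ld_mem g & forall i, `|f i - g i| <= e) ->
    ld_mem f
}.

Section LatData.
Variables (R : realType) (L : lat_data R).

Let semi (i : ld_idx L) (f : forall i : ld_idx L, ld_fib i) : R := `|f i|.

Let semiD k f g : semi k (fun i => f i + g i) <= semi k f + semi k g.
Proof. exact: ler_normD. Qed.

Let semiZ k a f : semi k (fun i => a *: f i) = `|a| * semi k f.
Proof. exact: normrZ. Qed.

Let semi_fin k : exists s : seq (ld_idx L), forall f, semi k f <= \sum_(i <- s) `|f i|.
Proof. by exists [:: k] => f; rewrite big_seq1. Qed.

Let semi_ev i : exists k, forall f : (forall i : ld_idx L, ld_fib i), `|f i| <= semi k f.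
Proof. by exists i. Qed.

Definition lat_sup_data : sup_data R :=
  @SupData R (ld_idx L) (fun i => ld_fib i) (ld_idx L) semi (@ld_mem R L)
    semiD semiZ semi_fin semi_ev (ld_mem0 L) (@ld_memD R L) (@ld_memZ R L)
    (@ld_bounded R L) (@ld_closed R L).

Definition lat_space := sup_space lat_sup_data.

HB.instance Definition _ := CompleteNormedModule.copy lat_space (sup_space lat_sup_data).

Definition lcoord (x : lat_space) (i : ld_idx L) : ld_fib i := scoord x i.

Lemma ld_memM (f g : forall i : ld_idx L, ld_fib i) :
  ld_mem f -> ld_mem g -> ld_mem (fun i => vmeet (f i) (g i)).
Proof.
move=> Lf Lg.
rewrite (_ : (fun i => _) = (fun i => (-1) *: vjoin ((-1) *: f i) ((-1) *: g i))).
  by apply: ld_memZ; apply: ld_memJ; apply: ld_memZ.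
by apply: functional_extensionality_dep => i; rewrite vmeetE !scaleN1r.
Qed.

Definition lle : rel lat_space := fun x y => `[< forall i, vle (lcoord x i) (lcoord y i) >].
Definition ljoin (x y : lat_space) : lat_space :=
  exist _ _ (ld_memJ (svalP x) (svalP y)).
Definition lmeet (x y : lat_space) : lat_space :=
  exist _ _ (ld_memM (svalP x) (svalP y)).

Let lle_refl : reflexive lle.
Proof. by move=> x; apply/asboolP => i; exact: vle_refl. Qed.
Let lle_anti : antisymmetric lle.
Proof.
move=> x y /andP[/asboolP xy /asboolP yx]; apply: sup_space_eq => i.
by apply: vle_anti; apply/andP; split; [exact: xy|exact: yx].
Qed.
Let lle_trans : transitive lle.
Proof.
by move=> y x z /asboolP xy /asboolP yz; apply/asboolP => i; exact: vle_trans (xy i) (yz i).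
Qed.
Let ljoinP x y z : lle (ljoin x y) z = lle x z && lle y z.
Proof.
apply/asboolP/andP => [H|[/asboolP xz /asboolP yz] i].
  by split; apply/asboolP => i; have := H i; rewrite vjoinP => /andP[].
by rewrite vjoinP xz yz.
Qed.
Let lmeetP x y z : lle z (lmeet x y) = lle z x && lle z y.
Proof.
apply/asboolP/andP => [H|[/asboolP xz /asboolP yz] i].
  by split; apply/asboolP => i; have := H i; rewrite vmeetP => /andP[].
by rewrite vmeetP xz yz.
Qed.
Let lle_add2r (x y z : lat_space) : lle x y -> lle (x + z) (y + z).
Proof. by move=> /asboolP xy; apply/asboolP => i; exact: vle_add2r (xy i). Qed.
Let lle_scale_ge0 (a : R) (x : lat_space) : 0 <= a -> lle 0 x -> lle 0 (a *: x).
Proof. by move=> a0 /asboolP x0; apply/asboolP => i; exact: vle_scale_ge0 (x0 i). Qed.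
Let lle_norm (x y : lat_space) : lle (ljoin x (- x)) (ljoin y (- y)) -> `|x| <= `|y|.
Proof.
move=> /asboolP xy; apply: sup_norm_le => // i.
by apply: le_trans (norm_scoord_le y i); apply: vle_norm; exact: xy.
Qed.

HB.instance Definition _ := isBanachLattice.Build R lat_space lle_refl lle_anti
  lle_trans ljoinP lmeetP lle_add2r lle_scale_ge0 lle_norm.

Lemma lcoordJ (x y : lat_space) i : lcoord (vjoin x y) i = vjoin (lcoord x i) (lcoord y i).
Proof. by []. Qed.
Lemma lcoordD (x y : lat_space) i : lcoord (x + y) i = lcoord x i + lcoord y i.
Proof. by []. Qed.
Lemma lcoordN (x : lat_space) i : lcoord (- x) i = - lcoord x i.
Proof. by []. Qed.
Lemma lcoordZ a (x : lat_space) i : lcoord (a *: x) i = a *: lcoord x i.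
Proof. by []. Qed.
Lemma vle_lcoord (x y : lat_space) : vle x y <-> forall i, vle (lcoord x i) (lcoord y i).
Proof. by split => [/asboolP|H]; last exact/asboolP. Qed.
Lemma norm_lcoord_le (x : lat_space) i : `|lcoord x i| <= `|x|.
Proof. exact: norm_scoord_le. Qed.
Lemma lat_norm_le (x : lat_space) M : 0 <= M -> (forall i, `|lcoord x i| <= M) -> `|x| <= M.
Proof. exact: (@sup_norm_le R lat_sup_data). Qed.
Lemma lat_space_eq (x y : lat_space) : (forall i, lcoord x i = lcoord y i) -> x = y.
Proof. exact: (@sup_space_eq R lat_sup_data). Qed.

End LatData.

Arguments lcoord : simpl never.

(** * The free Banach lattice *)

Section LinearFun.
Variables (R : pzRingType) (V W : lmodType R) (f : V -> W).

(** Carrying the proof of linearity as an argument gives the map a head symbol to which the linear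
    structure can be attached. *)
Definition linear_fun (_ : linear f) : V -> W := f.

Variable lf : linear f.
HB.instance Definition _ := GRing.isLinear.Build R V W *:%R (linear_fun lf) lf.

End LinearFun.

Section OpNorm.
Variables (R : realType) (V W : normedModType R) (T : {linear V -> W}).

Lemma opnorm_le M : 0 <= M -> (forall x, `|T x| <= M * `|x|) -> opnorm T <= M.
Proof.
move=> M0 HM; apply: ge_sup; first by exists `|T 0|; exists 0 => //=; rewrite normr0.
by move=> _ [x /= x1 <-]; apply: le_trans (HM x) _; rewrite ler_piMr.
Qed.

Hypothesis bT : bounded_op T.

Let opnorm_ubound : has_ubound [set `|T x| | x in [set x : V | `|x| <= 1]].
Proof.
(* [M] may be negative when [V] is trivial, hence the absolute value. *)
have [M HM] := bT; exists `|M| => _ [x /= x1 <-]; apply: le_trans (HM x) _.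
by apply: (@le_trans _ _ (`|M| * `|x|)); rewrite ?ler_wpM2r ?ler_norm// ler_piMr.
Qed.

Lemma opnorm_ge0 : 0 <= opnorm T.
Proof.
apply: ub_le_sup => //; exists 0 => //=; first by rewrite normr0.
by rewrite linear0 normr0.
Qed.

Lemma le_opnorm x : `|T x| <= opnorm T * `|x|.
Proof.
have [->|x0] := eqVneq x 0; first by rewrite linear0 !normr0 mulr0.
rewrite -ler_pdivrMr ?normr_gt0//; apply: ub_le_sup => //.
exists (`|x|^-1 *: x) => /=.
  by rewrite normrZ normfV normr_id mulVf ?normr_eq0.
by rewrite linearZ normrZ normfV normr_id mulrC.
Qed.

End OpNorm.

Lemma vle_scale (R : realType) (Y : banachLatticeType R) (b : R) (v w : Y) :
  0 <= b -> vle v w -> vle (b *: v) (b *: w).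
Proof.
move=> b0 vw; have := vle_add2r (- v) vw; rewrite subrr => /(vle_scale_ge0 b0).
by rewrite scalerBr => /(vle_add2r (b *: v)); rewrite add0r subrK.
Qed.

Lemma vjoinZ (R : realType) (Y : banachLatticeType R) (a : R) (x y : Y) :
  0 < a -> vjoin (a *: x) (a *: y) = a *: vjoin x y.
Proof.
move=> a0; apply: vle_anti; apply/andP; split.
  by rewrite vjoinP !vle_scale ?vle_joinl ?vle_joinr// ltW.
rewrite -[X in vle _ X](scale1r _) -(mulfV (lt0r_neq0 a0)) -scalerA.
apply: vle_scale; first exact: ltW.
have K z : z = a^-1 *: (a *: z) by rewrite scalerA mulVf ?scale1r ?gt_eqF.
rewrite vjoinP [X in vle X _ && _]K [X in _ && vle X _]K.
by rewrite !vle_scale ?vle_joinl ?vle_joinr// invr_ge0 ltW.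
Qed.

Section FreeBanachLattice.
Variables (R : realType) (E : completeNormedModType R).

(* No constructor for meets, since [x /\ y = - ((- x) \/ (- y))]. *)
Inductive lterm :=
  | Lvar of E
  | Ladd of lterm & lterm
  | Lscale of R & lterm
  | Ljoin of lterm & lterm.

Fixpoint leval (Y : banachLatticeType R) (T : E -> Y) (t : lterm) : Y :=
  match t with
  | Lvar x => T x
  | Ladd t s => leval T t + leval T s
  | Lscale a t => a *: leval T t
  | Ljoin t s => vjoin (leval T t) (leval T s)
  end.

Lemma levalD (Y : banachLatticeType R) (T : E -> Y) t s :
  leval T (Ladd t s) = leval T t + leval T s.
Proof. by []. Qed.

Lemma levalZ (Y : banachLatticeType R) (T : E -> Y) a t :
  leval T (Lscale a t) = a *: leval T t.
Proof. by []. Qed.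

Lemma levalJ (Y : banachLatticeType R) (T : E -> Y) t s :
  leval T (Ljoin t s) = vjoin (leval T t) (leval T s).
Proof. by []. Qed.

Record lin_contraction := LinContraction {
  ctr_space : banachLatticeType R;
  ctr_op : {linear E -> ctr_space};
  ctr_le : forall x, `|ctr_op x| <= `|x|
}.

Definition ctr_norm (c : lin_contraction) : lterm -> R := fun t => `|leval (ctr_op c) t|.

(* The pairs (Banach lattice, contraction) form a proper class; they are indexed by
   the norms they induce on lattice terms, which is all that the universal property
   depends on. *)
Definition fbl_index := {N : lterm -> R | exists c, N = ctr_norm c}.

Definition fbl_ctr (i : fbl_index) : lin_contraction := projT1 (cid (svalP i)).

Lemma fbl_ctrE (i : fbl_index) : ctr_norm (fbl_ctr i) = sval i.
Proof. by rewrite /fbl_ctr; case: cid. Qed.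

(** Uniform limits of lattice terms, that is, the closed sublattice generated by the image of [E] in
    the product. *)
Definition fbl_mem (f : forall i, ctr_space (fbl_ctr i)) : Prop :=
  forall e : R, 0 < e ->
  exists t, forall i, `|f i - leval (ctr_op (fbl_ctr i)) t| <= e.

Let mem0 : fbl_mem (fun i => 0).
Proof.
move=> e e0; exists (Lscale 0 (Lvar 0)) => i /=.
by rewrite scale0r subrr normr0 ltW.
Qed.

Let memD f g : fbl_mem f -> fbl_mem g -> fbl_mem (fun i => f i + g i).
Proof.
move=> ff fg e e0; have e20 : 0 < e / 2 by rewrite divr_gt0.
have [t Ht] := ff _ e20; have [s Hs] := fg _ e20; exists (Ladd t s) => i /=.
rewrite [e]splitr opprD addrACA; apply: le_trans (ler_normD _ _) _.
by rewrite lerD.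
Qed.

Let memZ a f : fbl_mem f -> fbl_mem (fun i => a *: f i).
Proof.
move=> ff e e0; have a0 : 0 < `|a| + 1 by rewrite ltr_wpDl.
have [t Ht] := ff (e / (`|a| + 1)) (divr_gt0 e0 a0).
exists (Lscale a t) => i /=; rewrite -scalerBr normrZ.
apply: (@le_trans _ _ ((`|a| + 1) * (e / (`|a| + 1)))).
  by apply: ler_pM; rewrite ?lerDl//; exact: Ht.
by rewrite mulrCA mulfV ?mulr1// gt_eqF.
Qed.

Let memJ f g : fbl_mem f -> fbl_mem g -> fbl_mem (fun i => vjoin (f i) (g i)).
Proof.
move=> ff fg e e0; have e20 : 0 < e / 2 by rewrite divr_gt0.
have [t Ht] := ff _ e20; have [s Hs] := fg _ e20; exists (Ljoin t s) => i /=.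
by rewrite [e]splitr; apply: le_trans (norm_vjoin_sub _ _ _ _) _; rewrite lerD.
Qed.

(** The bound depends on the term alone and serves all contractions at once; this is what makes the
    supremum norm finite on [fbl_mem]. *)
Lemma leval_bounded t :
  exists M : R, forall c : lin_contraction, `|leval (ctr_op c) t| <= M.
Proof.
elim: t => [x|t [M HM] s [K HK]|a t [M HM]|t [M HM] s [K HK]] /=.
- by exists `|x| => c; exact: ctr_le.
- by exists (M + K) => c; apply: le_trans (ler_normD _ _) _; rewrite lerD.
- by exists (`|a| * M) => c; rewrite normrZ; apply: ler_wpM2l => //; exact: HM.
- by exists (M + K) => c; apply: le_trans (norm_vjoin_le _ _) _; rewrite lerD.
Qed.

Let mem_bounded f : fbl_mem f -> exists M, forall i, `|f i| <= M.
Proof.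
move=> /(_ 1 ltr01) [t Ht]; have [M HM] := leval_bounded t.
exists (1 + M) => i; rewrite -[f i](subrK (leval (ctr_op (fbl_ctr i)) t)).
by apply: le_trans (ler_normD _ _) _; rewrite lerD.
Qed.

Let mem_closed f :
  (forall e, 0 < e -> exists2 g, fbl_mem g & forall i, `|f i - g i| <= e) ->
  fbl_mem f.
Proof.
move=> H e e0; have e20 : 0 < e / 2 by rewrite divr_gt0.
have [g Dg fg] := H _ e20; have [t Ht] := Dg _ e20; exists t => i.
rewrite -[f i](subrK (g i)) -addrA [e]splitr.
by apply: le_trans (ler_normD _ _) _; rewrite lerD.
Qed.

Definition fbl_data : lat_data R :=
  LatData mem0 memD memZ memJ mem_bounded mem_closed.

End FreeBanachLattice.

Notation fbl E := (lat_space (fbl_data E)).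

Lemma cvg_rate (R : realType) (Y : completeNormedModType R) (y : nat -> Y) (C : R) :
  (forall n m, `|y n - y m| <= C * (n.+1%:R^-1 + m.+1%:R^-1)) ->
  exists l : Y, y n @[n --> \oo] --> l.
Proof.
move=> H; suff : cvg (y n @[n --> \oo]) by move=> /cvg_ex.
apply: cauchy_cvg; apply/cauchy_ballP => e e0.
(* The [+ 1] keeps the denominator positive when [C] is [0]. *)
have C0 : 0 < 2 * `|C| + 1 by rewrite ltr_wpDl// mulr_ge0.
have [N _ HN] := near_infty_natSinv_lt (PosNum (divr_gt0 e0 C0)).
pose A := y @` [set n | (N <= n)%N].
have FA : (y n @[n --> \oo]) A by exists N => // n /= Nn; exists n.
exists (A, A) => //= -[_ _] [/= [n Nn <-] [m Nm <-]]; rewrite -ball_normE /=.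
have /= Hn := HN _ Nn; have /= Hm := HN _ Nm.
apply: le_lt_trans (H _ _) _.
apply: (@le_lt_trans _ _ (`|C| * (n.+1%:R^-1 + m.+1%:R^-1))).
  by rewrite ler_wpM2r ?ler_norm// addr_ge0 ?invr_ge0.
apply: (@le_lt_trans _ _ (`|C| * (2 * (e / (2 * `|C| + 1))))).
  by rewrite ler_wpM2l// mulr2n mulrDl !mul1r ltW// ltrD.
rewrite [X in X < _](_ : _ = 2 * `|C| * e / (2 * `|C| + 1)); last by ring.
by rewrite ltr_pdivrMr// mulrC ltr_pM2l// ltrDl.
Qed.

(** * The universal property *)

Section FreeExtension.
Variables (R : realType) (E : completeNormedModType R).
Notation F := (fbl E).

Lemma fbl_gen_mem (x : E) :
  fbl_mem (fun i => ctr_op (fbl_ctr i) x).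
Proof. by move=> e e0; exists (Lvar x) => i /=; rewrite subrr normr0 ltW. Qed.

Definition fbl_gen_fun (x : E) : F := exist _ _ (fbl_gen_mem x).

Lemma fbl_gen_linear : linear fbl_gen_fun.
Proof.
move=> a x y; apply: lat_space_eq => i.
by rewrite lcoordD lcoordZ /lcoord /scoord /= linearP.
Qed.

Definition fbl_gen : {linear E -> F} := linear_fun fbl_gen_linear.

Lemma fbl_gen_coord (x : E) i : lcoord (fbl_gen x) i = ctr_op (fbl_ctr i) x.
Proof. by []. Qed.

Lemma fbl_gen_le x : `|fbl_gen x| <= `|x|.
Proof. by apply: lat_norm_le => // i; rewrite fbl_gen_coord ctr_le. Qed.

Lemma leval_coord t i :
  lcoord (leval fbl_gen t) i = leval (ctr_op (fbl_ctr i)) t.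
Proof.
elim: t => [x|t IHt s IHs|a t IHt|t IHt s IHs] //=.
- by rewrite lcoordD IHt IHs.
- by rewrite lcoordZ IHt.
- by rewrite lcoordJ IHt IHs.
Qed.

Lemma fbl_dense (z : F) (e : R) : 0 < e -> exists t, `|z - leval fbl_gen t| <= e.
Proof.
move=> e0; have [t Ht] := svalP z e e0; exists t.
apply: lat_norm_le => [|i]; first exact: ltW.
by rewrite lcoordD lcoordN leval_coord; exact: Ht.
Qed.

Section Extension.
Variables (Y : banachLatticeType R) (T : {linear E -> Y}).
Hypothesis bT : bounded_op T.

(** Dividing [T] by [c] gives a contraction, whose norm on terms is one of those over which the norm
    of [fbl E] is a supremum. Positive homogeneity of joins carries the estimate back to [T]. *)
Lemma leval_le_pos c t : 0 < c -> (forall x, `|T x| <= c * `|x|) ->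
  `|leval T t| <= c * `|leval fbl_gen t|.
Proof.
move=> c0 HT.
have lT' : linear (fun x => c^-1 *: T x : Y).
  by move=> a x y; rewrite linearP scalerDr !scalerA mulrC.
pose T' : {linear E -> Y} := linear_fun lT'.
have T'1 x : `|T' x| <= `|x|.
  by rewrite /T' /linear_fun /= normrZ normfV gtr0_norm// ler_pdivrMl.
have T'E s : leval T' s = c^-1 *: leval T s.
  elim: s => [x|s1 IH1 s2 IH2|a s IH|s1 IH1 s2 IH2] //=.
  - by rewrite IH1 IH2 scalerDr.
  - by rewrite IH !scalerA mulrC.
  - by rewrite IH1 IH2 vjoinZ// invr_gt0.
pose C := LinContraction T'1.
(* The contraction chosen to represent the index [i] may differ from [C], but it induces the same
   norm on terms. *)
have [i iC] : exists i : fbl_index E, ctr_norm (fbl_ctr i) = ctr_norm C.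
  have exC : exists c, ctr_norm C = ctr_norm c by exists C.
  by exists (exist _ (ctr_norm C) exC); rewrite fbl_ctrE.
have := norm_lcoord_le (leval fbl_gen t) i; rewrite leval_coord.
have := congr1 (fun N => N t) iC; rewrite /ctr_norm /= => ->.
by rewrite T'E normrZ normfV gtr0_norm// ler_pdivrMl.
Qed.

(** The operator norm may be [0], which cannot be divided by; so [leval_le_pos] is applied to
    slightly larger constants, and the excess then tends to [0]. *)
Lemma leval_le t : `|leval T t| <= opnorm T * `|leval fbl_gen t|.
Proof.
apply/ler_addgt0Pr => e e0.
have d0 : 0 < `|leval fbl_gen t| + 1 by rewrite ltr_wpDl.
pose d := e / (`|leval fbl_gen t| + 1).
have dp : 0 < d by rewrite divr_gt0.
have H : `|leval T t| <= (opnorm T + d) * `|leval fbl_gen t|.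
  apply: leval_le_pos => [|x]; first by rewrite ltr_wpDl ?opnorm_ge0.
  apply: le_trans (le_opnorm bT x) _.
  by rewrite ler_wpM2r// lerDl ltW.
apply: le_trans H _; rewrite mulrDl lerD2l.
by rewrite /d -mulrA ler_piMr ?(ltW e0)// mulrC ler_pdivrMr// mul1r lerDl.
Qed.

Lemma leval_sub_le t s :
  `|leval T t - leval T s| <= opnorm T * `|leval fbl_gen t - leval fbl_gen s|.
Proof. by have := leval_le (Ladd t (Lscale (-1) s)); rewrite /= !scaleN1r. Qed.

(** Extension by uniform continuity. The inequality, required for every term [t], determines [y]
    since terms are dense; no independence of the approximating sequence has to be shown. *)
Lemma ext_value (z : F) :
  exists y, forall t, `|y - leval T t| <= opnorm T * `|z - leval fbl_gen t|.
Proof.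
have /choice[t Ht] (n : nat) : exists t, `|z - leval fbl_gen t| <= n.+1%:R^-1.
  by apply: fbl_dense; rewrite invr_gt0.
have [n m|l Hl] := @cvg_rate R Y (fun n => leval T (t n)) (opnorm T).
  apply: le_trans (leval_sub_le _ _) _; rewrite ler_wpM2l ?opnorm_ge0//.
  by apply: le_trans (ler_distD z _ _) _; rewrite lerD// distrC.
exists l => s; apply/ler_addgt0Pr => e e0.
have c0 : 0 < opnorm T + 1 by rewrite ltr_wpDl ?opnorm_ge0.
have e1 : 0 < e / (opnorm T + 1) / 2 by rewrite !divr_gt0.
have e2 : 0 < e / 2 by rewrite divr_gt0.
have : \forall n \near \oo, `|l - leval T (t n)| <= e / 2 /\
    n.+1%:R^-1 < e / (opnorm T + 1) / 2.
  apply: filterI; first by move/cvgrPdist_le : Hl; exact.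
  exact: near_infty_natSinv_lt (PosNum e1).
move=> /filter_ex [n [ln nn]].
apply: le_trans (ler_distD (leval T (t n)) _ _) _.
rewrite addrC [e]splitr addrA; apply: lerD => //.
apply: le_trans (leval_sub_le _ _) _.
apply: le_trans (ler_wpM2l (opnorm_ge0 bT) (ler_distD z _ _)) _.
rewrite mulrDr [leLHS]addrC lerD2l distrC.
apply: le_trans (ler_wpM2l (opnorm_ge0 bT) (le_trans (Ht n) (ltW nn))) _.
rewrite mulrA ler_wpM2r ?invr_ge0// mulrCA ler_piMr ?(ltW e0)//.
by rewrite ler_pdivrMr// mul1r lerDl.
Qed.

Definition ext_fun (z : F) : Y := projT1 (cid (ext_value z)).

Lemma ext_funP z t : `|ext_fun z - leval T t| <= opnorm T * `|z - leval fbl_gen t|.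
Proof. by rewrite /ext_fun; case: cid. Qed.

Lemma ext_fun_leval t : ext_fun (leval fbl_gen t) = leval T t.
Proof.
apply/eqP; rewrite -subr_eq0 -normr_le0; apply: le_trans (ext_funP _ t) _.
by rewrite subrr normr0 mulr0.
Qed.

(** Linearity and preservation of joins hold exactly on terms; this form of continuity transfers
    them to all of [fbl E]. *)
Lemma ext_fun_near (e : R) : 0 < e -> exists2 d : R, 0 < d & forall z t,
  `|z - leval fbl_gen t| <= d -> `|ext_fun z - leval T t| <= e.
Proof.
move=> e0; have c0 : 0 < opnorm T + 1 by rewrite ltr_wpDl ?opnorm_ge0.
exists (e / (opnorm T + 1)) => [|z t zt]; first by rewrite divr_gt0.
apply: le_trans (ext_funP _ _) _.
apply: le_trans (ler_wpM2l (opnorm_ge0 bT) zt) _.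
by rewrite mulrCA ler_piMr ?(ltW e0)// ler_pdivrMr// mul1r lerDl.
Qed.

Lemma ext_fun_linear : linear ext_fun.
Proof.
move=> a z w; apply/eqP; rewrite -subr_eq0 -normr_le0.
apply/ler_addgt0Pr => e e0; rewrite add0r.
have a0 : 0 < `|a| + 1 by rewrite ltr_wpDl.
have e3 : 0 < e / 2 by rewrite divr_gt0.
have e4 : 0 < e / 2 / (`|a| + 1) by rewrite divr_gt0.
have [d1 d10 H1] := ext_fun_near e3; have [d2 d20 H2] := ext_fun_near e4.
have d3 : 0 < Num.min (d1 / (`|a| + 1)) d2 by rewrite lt_min divr_gt0.
have [t Ht] := fbl_dense z d3; have [s Hs] := fbl_dense w d3.
have comb (V : normedModType R) (c : R) (v v' u u' : V) : `|v - v'| <= c -> `|u - u'| <= c ->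
    `|(a *: v + u) - (a *: v' + u')| <= (`|a| + 1) * c.
  move=> vc uc; rewrite opprD addrACA -scalerBr; apply: le_trans (ler_normD _ _) _.
  by rewrite normrZ mulrDl mul1r lerD// ler_wpM2l.
rewrite -(subrK (leval T (Ladd (Lscale a t) s)) (ext_fun _)) -addrA [e]splitr.
apply: le_trans (ler_normD _ _) _; apply: lerD.
  apply: H1 => /=; apply: (le_trans (comb _ _ _ _ _ _ Ht Hs)).
  by rewrite mulrC -ler_pdivlMr// ge_min lexx.
rewrite distrC /=; have -> : e / 2 = (`|a| + 1) * (e / 2 / (`|a| + 1)).
  by rewrite mulrCA mulfV ?mulr1// gt_eqF.
by apply: comb; apply: H2; [apply: le_trans Ht _|apply: le_trans Hs _];
  rewrite ge_min lexx orbT.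
Qed.

Definition fbl_ext : {linear F -> Y} := linear_fun ext_fun_linear.

Lemma fbl_ext_le z : `|fbl_ext z| <= opnorm T * `|z|.
Proof.
have := ext_funP z (Lscale 0 (Lvar 0)).
by rewrite /= !scale0r !subr0.
Qed.

Lemma fbl_ext_gen x : fbl_ext (fbl_gen x) = T x.
Proof. exact: (ext_fun_leval (Lvar x)). Qed.

Lemma fbl_extJ z w : fbl_ext (vjoin z w) = vjoin (fbl_ext z) (fbl_ext w).
Proof.
apply/eqP; rewrite -subr_eq0 -normr_le0.
apply/ler_addgt0Pr => e e0; rewrite add0r.
have e3 : 0 < e / 2 by rewrite divr_gt0.
have e4 : 0 < e / 2 / 2 by rewrite divr_gt0.
have [d1 d10 H1] := ext_fun_near e3; have [d2 d20 H2] := ext_fun_near e4.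
(* [d1] is halved because [norm_vjoin_sub] adds the errors of both arguments. *)
have d3 : 0 < Num.min (d1 / 2) d2 by rewrite lt_min divr_gt0.
have [t Ht] := fbl_dense z d3; have [s Hs] := fbl_dense w d3.
rewrite -(subrK (leval T (Ljoin t s)) (fbl_ext _)) -addrA [e]splitr.
apply: le_trans (ler_normD _ _) _; apply: lerD.
  apply: H1 => /=; apply: (le_trans (norm_vjoin_sub _ _ _ _)).
  apply: (le_trans (lerD Ht Hs)); rewrite [leRHS]splitr lerD// ge_min lexx//.
rewrite distrC /= [e / 2]splitr; apply: le_trans (norm_vjoin_sub _ _ _ _) _.
by apply: lerD; apply: H2; [apply: le_trans Ht _|apply: le_trans Hs _];
  rewrite ge_min lexx orbT.
Qed.

Lemma fbl_ext_hom : blat_hom fbl_ext.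
Proof.
split; [by exists (opnorm T); exact: fbl_ext_le|exact: fbl_extJ|move=> x y].
by rewrite !vmeetE -!linearN -fbl_extJ linearN.
Qed.

End Extension.

Lemma blat_hom_leval (Y : banachLatticeType R) (T : {linear E -> Y})
    (S : {linear F -> Y}) : blat_hom S -> (forall x, S (fbl_gen x) = T x) ->
  forall t, S (leval fbl_gen t) = leval T t.
Proof.
move=> [_ SJ _] ST; elim => [x|t IHt s IHs|a t IHt|t IHt s IHs].
- exact: ST.
- by rewrite !levalD linearD IHt IHs.
- by rewrite !levalZ linearZ IHt.
- by rewrite !levalJ SJ IHt IHs.
Qed.

(** The extension has norm at most that of [T] by [fbl_ext_le], and at least that because [fbl_gen]
    is a contraction. Uniqueness holds because two extensions agree on lattice terms, which are
    dense. *)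
Lemma fbl_is_FBL : is_FBL fbl_gen.
Proof.
split; first by exists 1 => x; rewrite mul1r; exact: fbl_gen_le.
move=> Y T bT; exists (fbl_ext bT) => [|S [Shom ST _] z].
  split; [exact: fbl_ext_hom|exact: fbl_ext_gen|].
  have bS : bounded_op (fbl_ext bT) by have [] := fbl_ext_hom bT.
  apply/le_anti; rewrite opnorm_le ?opnorm_ge0//=; last exact: fbl_ext_le.
  apply: opnorm_le => [|x]; first exact: opnorm_ge0.
  rewrite -(fbl_ext_gen bT) ; apply: le_trans (le_opnorm bS _) _.
  by rewrite ler_wpM2l ?opnorm_ge0 ?fbl_gen_le.
have [[M HM] _ _] := Shom.
apply/eqP; rewrite -subr_eq0 -normr_le0; apply/ler_addgt0Pr => e e0; rewrite add0r.
have M0 : 0 < `|M| + opnorm T + 1 by rewrite ltr_wpDl ?addr_ge0 ?opnorm_ge0.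
have [t Ht] := fbl_dense z (divr_gt0 e0 M0).
apply: le_trans (ler_distD (leval T t) _ _) _.
rewrite -[in X in X + _](blat_hom_leval Shom ST) -linearB.
rewrite [X in _ + X]distrC.
apply: (@le_trans _ _ ((`|M| + opnorm T + 1) * `|z - leval fbl_gen t|)); last first.
  by rewrite mulrC -ler_pdivlMr.
rewrite -addrA mulrDl lerD//.
  by apply: le_trans (HM _) _; rewrite ler_wpM2r ?ler_norm.
by apply: le_trans (ext_funP _ _ _) _; rewrite ler_wpM2r// lerDl.
Qed.

End FreeExtension.

(** * The gliding hump *)

(* The sum over [a] of [sup_b p a b] is thought of as an [l_1]-norm on [E]; [hb a b w] is
   a functional dominated by [p a b] and norming [w], as given by Hahn-Banach. *)
Section GlidingHump.
Variables (R : realType) (E : normedModType R) (A B : eqType).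
Variables (p : A -> B -> E -> R) (hb : A -> B -> E -> E -> R) (C : R).
Hypothesis hb_linear : forall a b w, linear (hb a b w : E -> R^o).
Hypothesis hb_le : forall a b w y, `|hb a b w y| <= p a b y.
Hypothesis hb_eq : forall a b w, hb a b w w = p a b w.
Hypothesis p_sum : forall (l : seq (A * B)) y, uniq (unzip1 l) ->
  \sum_(z <- l) p z.1 z.2 y <= C * `|y|.
Variable x : nat -> E.
Hypothesis x_weak : weakly_cvg x 0.
Hypothesis x_small : forall a (e : R), 0 < e ->
  \forall k \near \oo, forall b, p a b (x k) <= e.

Implicit Types (l : seq (A * B)) (L t r : seq (A * (B * E))).

(** A list [L] encodes a functional [V L]: an entry [(a, (b, w))] contributes the functional below
    [p a b] that norms [w]. [W L] sums the absolute values of these contributions. *)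
Let V L y := \sum_(z <- L) hb z.1 z.2.1 z.2.2 y.
Let W L y := \sum_(z <- L) `|hb z.1 z.2.1 z.2.2 y|.
Let tests L : seq (A * B) := [seq (z.1, z.2.1) | z <- L].

Let tests_keys L : unzip1 (tests L) = unzip1 L.
Proof. by rewrite /unzip1 -map_comp. Qed.

Let V_le_W L y : `|V L y| <= W L y.
Proof. exact: ler_norm_sum. Qed.

Let W_le_p L y : W L y <= \sum_(z <- tests L) p z.1 z.2 y.
Proof. by rewrite big_map ler_sum. Qed.

Let W_bounded L y : uniq (unzip1 L) -> W L y <= C * `|y|.
Proof. by move=> uL; apply: le_trans (W_le_p _ _) _; apply: p_sum; rewrite tests_keys. Qed.

Let V_cat L t y : V (t ++ L) y = V t y + V L y.
Proof. by rewrite /V big_cat. Qed.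

Let V_linear L c y z : V L (c *: y + z) = c * V L y + V L z.
Proof.
rewrite /V mulr_sumr -big_split /=; apply: eq_bigr => w _.
exact: (hb_linear _ _ _ c y z).
Qed.

(** A list with distinct keys in [s] has at most [size s] entries, each of them eventually small
    uniformly in [b]. *)
Let head_small (s : seq A) (e : R) : 0 < e ->
  \forall k \near \oo, forall l, uniq (unzip1 l) -> {subset unzip1 l <= s} ->
    \sum_(z <- l) p z.1 z.2 (x k) <= e.
Proof.
move=> e0; have d0 : 0 < e / (size s).+1%:R by rewrite divr_gt0.
have : \forall k \near \oo, forall a, a \in s -> forall b, p a b (x k) <= e / (size s).+1%:R.
  elim: {1 3}s => [|a s' IH]; first exact: nearW.
  have := x_small a d0; apply: filterS2 IH => k IH H b; rewrite in_cons.
  by move=> /orP[/eqP ->//|/IH].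
apply: filterS => k Hk l ul ls.
apply: (@le_trans _ _ (\sum_(z <- l) e / (size s).+1%:R)).
  rewrite big_seq [leRHS]big_seq; apply: ler_sum => z zl.
  by apply: Hk; apply: ls; exact: map_f.
rewrite big_const_seq count_predT iter_addr_0 -[leLHS]mulr_natr -mulrA ler_piMr ?(ltW e0)//.
rewrite mulrC ler_pdivrMr// mul1r ler_nat.
by have := uniq_leq_size ul ls; rewrite size_map => /leq_trans; apply.
Qed.

Section Failure.
Variable e : R.
Hypothesis e0 : 0 < e.
Hypothesis big_often : forall N : nat, exists2 k, (N <= k)%N &
  exists2 l, uniq (unzip1 l) & e < \sum_(z <- l) p z.1 z.2 (x k).

(* [L] is the functional built so far and [t] its next summand; [x k] is almost
   concentrated on the coordinates of [t], which norms it there. *)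
Let hump L t k :=
  [/\ `|V L (x k)| <= e / 8, e * 7 / 8 <= V t (x k) &
      forall r, uniq (unzip1 (r ++ t ++ L)) -> `|V r (x k)| <= e / 8].

(** For late [k] the vector [x k] is small on the keys of [L]. A nearly optimal family of tests for
    [x k], with these keys removed, gives [t]; near optimality leaves little of [x k] on any further
    keys. *)
Let next_hump L N : uniq (unzip1 L) ->
  exists t k, [/\ uniq (unzip1 (t ++ L)), (N <= k)%N & hump L t k].
Proof.
move=> uL; have e8 : 0 < e / 8 by rewrite divr_gt0.
have [N' _ HN'] := head_small (unzip1 L) e8.
have [k Nk [l1 ul1 el1]] := big_often (maxn N N').
have Hk := HN' k (leq_trans (leq_maxr _ _) Nk).
pose S := [set r | exists2 l, uniq (unzip1 l) & r = \sum_(z <- l) p z.1 z.2 (x k)].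
have Sub : has_ubound S by exists (C * `|x k|) => _ [l ul ->]; exact: p_sum.
have Sle l : uniq (unzip1 l) -> \sum_(z <- l) p z.1 z.2 (x k) <= sup S.
  by move=> ul; apply: ub_le_sup => //; exists l.
have Se : e < sup S by apply: lt_le_trans el1 (Sle _ ul1).
(* The family [l] is to exceed [e] and also to come within [e / 8] of the supremum. *)
have [||_ [l ul ->] Hl] := @sup_gt _ S (Num.max e (sup S - e / 8)).
- by exists (\sum_(z <- l1) p z.1 z.2 (x k)), l1.
- by rewrite gt_max Se ltrBlDr ltrDl.
move: Hl; rewrite gt_max => /andP[el Sl].
pose l' := [seq z <- l | z.1 \notin unzip1 L].
pose t : seq (A * (B * E)) := [seq (z.1, (z.2, x k)) | z <- l'].
have tl' : unzip1 t = [seq a <- unzip1 l | a \notin unzip1 L].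
  by rewrite /t /unzip1 -map_comp filter_map.
have utL : uniq (unzip1 (t ++ L)).
  rewrite /unzip1 map_cat -!/(unzip1 _) cat_uniq uL andbT tl' filter_uniq//=.
  by apply/hasPn => a aL; rewrite mem_filter /= aL.
have lL : \sum_(z <- l | z.1 \in unzip1 L) p z.1 z.2 (x k) <= e / 8.
  rewrite -big_filter; apply: Hk.
    by apply: subseq_uniq ul; rewrite map_subseq// filter_subseq.
  by move=> a /mapP[z]; rewrite mem_filter => /andP[zL _] ->.
exists t, k; split => //; first exact: leq_trans (leq_maxl _ _) Nk.
split.
- apply: le_trans (V_le_W _ _) _; apply: le_trans (W_le_p _ _) _.
  by apply: Hk; rewrite tests_keys.
(* Every functional in [t] norms [x k], and the removed keys cost at most [e / 8] out of [e]. *)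
- have -> : V t (x k) = \sum_(z <- l') p z.1 z.2 (x k).
    by rewrite /V big_map; apply: eq_bigr => z _; rewrite hb_eq.
  rewrite big_filter; move: el; rewrite (bigID (fun z => z.1 \in unzip1 L)) /=.
  lra.
(* The keys of [l] lie in [t] or [L], so [r] may be adjoined to [l]; the supremum leaves at most
   [e / 8] for it. *)
- move=> r ur; apply: le_trans (V_le_W _ _) _; apply: le_trans (W_le_p _ _) _.
  have := Sle (tests r ++ l).
  rewrite big_cat /=; set Sr := \sum_(z <- tests r) _; set Sl' := \sum_(z <- l) _.
  suff H : uniq (unzip1 (tests r ++ l)) by move=> /(_ H); move: Sl; rewrite -/Sl'; lra.
  rewrite /unzip1 map_cat -!/(unzip1 _) cat_uniq ul andbT tests_keys.
  move: ur; rewrite /unzip1 map_cat -!/(unzip1 _) cat_uniq => /and3P[-> + _] /=.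
  apply: contra => /hasP[a al ar]; apply/hasP; exists a => //.
  rewrite /unzip1 map_cat mem_cat -!/(unzip1 _) tl' mem_filter.
  by case: (a \in unzip1 L) => //=; rewrite ?al ?orbT.
Qed.

Let humps : exists Lk : nat -> seq (A * (B * E)) * nat,
  (forall j, uniq (unzip1 (Lk j).1)) /\
  forall j, exists t, [/\ (Lk j.+1).1 = t ++ (Lk j).1, (j <= (Lk j.+1).2)%N &
    hump (Lk j).1 t (Lk j.+1).2].
Proof.
pose st := {L : seq (A * (B * E)) | uniq (unzip1 L)}.
(* The state records the functional, a step counter and the last index; the counter forces the
   [j]-th index to be at least [j]. *)
pose rel (u v : st * nat * nat) := v.1.2 = u.1.2.+1 /\
  exists t, [/\ sval v.1.1 = t ++ sval u.1.1, (u.1.2 <= v.2)%N & hump (sval u.1.1) t v.2].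
have [|f [f0 Hf]] := @dependent_choice _ rel _ (exist _ [::] isT : st, 0%N, 0%N).
  move=> [[[L uL] j] k0]; apply: cid.
  have [t [k [utL jk H]]] := next_hump j uL.
  exists (exist _ (t ++ L) utL, j.+1, k).
  by split => //; exists t.
have fj j : (f j).1.2 = j.
  by elim: j => [|j IH]; [rewrite f0|have [-> _] := Hf j; rewrite IH].
exists (fun j => (sval (f j).1.1, (f j).2)); split => [j|j /=]; first exact: (svalP (f j).1.1).
by have [_ [t [tE jk H]]] := Hf j; exists t; split => //; rewrite -{1}[j]fj.
Qed.

(** The functionals [V (L j)] converge pointwise to a bounded functional which stays above [e / 2]
    along the hump indices. These indices are arbitrarily large, against weak convergence to [0]. *)
Lemma hump_contradiction : False.
Proof.
have [Lk [uL HL]] := humps; pose L j := (Lk j).1.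
have Wmono y : {homo (fun j => W (L j) y) : n m / (n <= m)%N >-> n <= m}.
  apply/nondecreasing_seqP => j; have [t [tE _ _]] := HL j.
  by rewrite /L tE /W big_cat /= lerDr sumr_ge0.
(* Each new summand has the form [h + |h|], which is nonnegative. So [V] is a difference of two
   bounded nondecreasing sequences. *)
have VWmono y : {homo (fun j => V (L j) y + W (L j) y) : n m / (n <= m)%N >-> n <= m}.
  apply/nondecreasing_seqP => j; have [t [tE _ _]] := HL j.
  rewrite /L tE V_cat /W big_cat /= addrACA lerDr -big_split /=; apply: sumr_ge0 => z _.
  by rewrite -lerBlDr sub0r lerNl ler_normr lexx orbT.
have Wcvg y : cvgn (fun j => W (L j) y).
  apply: nondecreasing_is_cvgn; first exact: Wmono.
  by exists (C * `|y|) => _ [j _ <-]; exact: W_bounded (uL j).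
have VWcvg y : cvgn (fun j => V (L j) y + W (L j) y).
  apply: nondecreasing_is_cvgn; first exact: VWmono.
  exists (C * `|y| + C * `|y|) => _ [j _ <-]; apply: lerD; last exact: W_bounded (uL j).
  by apply: le_trans (ler_norm _) _; apply: le_trans (V_le_W _ _) _; exact: W_bounded (uL j).
have Vcvg y : cvgn (fun j => V (L j) y).
  rewrite (_ : (fun j => _) = (fun j => (V (L j) y + W (L j) y) - W (L j) y)).
    exact: is_cvgB.
  by apply/funext => j; rewrite addrK.
pose f y : R^o := lim (V (L j) y @[j --> \oo]).
have flin : linear f.
  move=> c y z; apply: cvg_lim => //.
  rewrite (_ : (fun j => _) = (fun j => c *: (V (L j) y : R^o) + V (L j) z)).
    by apply: cvgD; [apply: cvgZr; exact: Vcvg|exact: Vcvg].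
  apply/funext => j; exact: V_linear.
have fbd : bounded_op (linear_fun flin).
  exists C => y; rewrite /linear_fun /=.
  rewrite ler_norml; apply/andP; split.
    apply: limr_ge; first exact: Vcvg.
    apply: nearW => j; rewrite lerNl; apply: le_trans (W_bounded y (uL j)).
    by apply: le_trans (V_le_W _ _); rewrite ler_normr lexx orbT.
  apply: limr_le; first exact: Vcvg.
  apply: nearW => j; apply: le_trans (W_bounded y (uL j)).
  exact: le_trans (ler_norm _) (V_le_W _ _).
have := x_weak fbd; rewrite linear0 => /cvgrPdist_le.
have e2 : 0 < e / 2 by rewrite divr_gt0.
move=> /(_ _ e2) [N _ HN].
have [t [tE Nk [H1 H2 H3]]] := HL N.
have := HN _ Nk; rewrite /= sub0r normrN.
(* The current hump contributes [7 / 8]; the earlier and the later ones take away at most [1 / 8]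
   each. *)
suff : e * 5 / 8 <= f (x (Lk N.+1).2).
  move=> H /(le_trans (ler_norm _)) /(le_trans H); move: e0; rewrite /linear_fun; lra.
apply: limr_ge; first exact: Vcvg.
exists N.+1 => // j /= Nj.
have [r rE] : exists r, L j = r ++ L N.+1.
  elim: j Nj => // j IH; rewrite leq_eqVlt => /orP[/eqP <-|/IH [r rE]]; first by exists [::].
  have [t' [tE' _ _]] := HL j.
  by exists (t' ++ r); rewrite /L tE' -/(L j) rE catA.
have ur : uniq (unzip1 (r ++ t ++ (Lk N).1)) by rewrite -tE -/(L _) -rE; exact: uL.
have := H3 _ ur; have := H1; rewrite rE V_cat /L tE V_cat !ler_norml.
move=> /andP[h1 _] /andP[h2 _]; move: H2; lra.
Qed.

End Failure.

(** Smallness at each key becomes smallness of the whole sum. It is used twice: with the coordinates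
    of one block as keys, then with the blocks themselves as keys. *)
Lemma gliding_hump (e : R) : 0 < e ->
  \forall k \near \oo, forall l, uniq (unzip1 l) ->
    \sum_(z <- l) p z.1 z.2 (x k) <= e.
Proof.
move=> e0; apply: contrapT => H; apply: (hump_contradiction e0) => N.
apply: contrapT => HN; apply: H; exists N => // k /= Nk l ul.
by rewrite leNgt; apply/negP => el; apply: HN; exists k => //; exists l.
Qed.

End GlidingHump.

(** * The Schur space *)

Section BlockSpace.
Variables (R : realType) (G : eqType).
Implicit Types (n : nat) (b : G * seq G) (g : G) (s : seq G).

(* The supremum over [b] is the norm of [E_n]. *)
Definition block_test n b (x : nat * G -> R) : R :=
  `|x (n, b.1)| + n.+1%:R^-1 * \sum_(g <- undup b.2) `|x (n, g)|.

(** One test for each of finitely many blocks; distinct keys make the supremum of [block_semi] the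
    [l_1]-sum of the block norms. *)
Definition block_tests := {l : seq (nat * (G * seq G)) | uniq (unzip1 l)}.

Definition block_semi (l : block_tests) (x : nat * G -> R^o) : R :=
  \sum_(z <- sval l) block_test z.1 z.2 x.

Lemma block_testD n b (x y : nat * G -> R^o) :
  block_test n b (fun i => x i + y i) <= block_test n b x + block_test n b y.
Proof.
rewrite /block_test addrACA -mulrDr -big_split /=.
apply: lerD; first exact: (@ler_normD R R).
by rewrite ler_wpM2l ?invr_ge0//; apply: ler_sum => g _; exact: (@ler_normD R R).
Qed.

Lemma block_testZ n b (a : R) (x : nat * G -> R^o) :
  block_test n b (fun i => a *: x i) = `|a| * block_test n b x.
Proof.
rewrite /block_test mulrDr mulrCA; congr (_ + _ * _); first exact: normrM.
by rewrite mulr_sumr; apply: eq_bigr => g _; exact: normrM.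
Qed.

Lemma block_test_fin n b : exists s : seq (nat * G),
  forall x : nat * G -> R^o, block_test n b x <= \sum_(i <- s) `|x i|.
Proof.
exists ((n, b.1) :: [seq (n, g) | g <- undup b.2]) => x.
rewrite big_cons big_map lerD2l ler_piMl ?sumr_ge0//.
by rewrite invf_le1 ?ler1n.
Qed.

Let semiD l (x y : nat * G -> R^o) :
  block_semi l (fun i => x i + y i) <= block_semi l x + block_semi l y.
Proof. by rewrite /block_semi -big_split; apply: ler_sum => z _; exact: block_testD. Qed.

Let semiZ l (a : R) (x : nat * G -> R^o) :
  block_semi l (fun i => a *: x i) = `|a| * block_semi l x.
Proof. by rewrite /block_semi mulr_sumr; apply: eq_bigr => z _; exact: block_testZ. Qed.

Let semi_fin l : exists s : seq (nat * G),
  forall x : nat * G -> R^o, block_semi l x <= \sum_(i <- s) `|x i|.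
Proof.
rewrite /block_semi; elim: (sval l) => [|z l' [s Hs]].
  by exists [::] => x; rewrite !big_nil.
have [t Ht] := block_test_fin z.1 z.2; exists (t ++ s) => x.
by rewrite big_cons big_cat; exact: lerD.
Qed.

Definition block_single n b : block_tests := exist _ [:: (n, b)] isT.

Lemma block_semi_single n b x : block_semi (block_single n b) x = block_test n b x.
Proof. by rewrite /block_semi /= big_seq1. Qed.

Let semi_ev (i : nat * G) : exists l, forall x : nat * G -> R^o, `|x i| <= block_semi l x.
Proof.
case: i => n g; exists (block_single n (g, [::])) => x.
by rewrite block_semi_single /block_test /= big_nil mulr0 addr0.
Qed.

Let mem (x : nat * G -> R^o) := exists M, forall l, block_semi l x <= M.

Let mem0 : mem (fun i => 0).
Proof.
exists 0 => l; rewrite /block_semi big1// => z _.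
by rewrite /block_test normr0 big1 ?mulr0 ?addr0// => g _; rewrite normr0.
Qed.

Let memD x y : mem x -> mem y -> mem (fun i => x i + y i).
Proof.
by move=> [M HM] [K HK]; exists (M + K) => l; apply: le_trans (semiD _ _ _) _; rewrite lerD.
Qed.

Let memZ (a : R) x : mem x -> mem (fun i => a *: x i).
Proof. by move=> [M HM]; exists (`|a| * M) => l; rewrite semiZ ler_wpM2l. Qed.

Let mem_closed x :
  (forall e, 0 < e -> exists2 y, mem y & forall l, block_semi l (fun i => x i - y i) <= e) ->
  mem x.
Proof.
move=> /(_ 1 ltr01) [y [M HM] xy]; exists (1 + M) => l.
have -> : x = (fun i => (x i - y i) + y i) by apply/funext => i; rewrite subrK.
by apply: le_trans (semiD _ _ _) _; rewrite lerD.
Qed.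

Definition block_data : sup_data R :=
  @SupData R (nat * G)%type (fun=> R^o) block_tests block_semi mem semiD semiZ
    semi_fin semi_ev mem0 memD memZ (fun x mx => mx) mem_closed.

Definition block_space := sup_space block_data.
HB.instance Definition _ := CompleteNormedModule.copy block_space (sup_space block_data).

Definition entry (x : block_space) (i : nat * G) : R := scoord x i.

Lemma entryD x y i : entry (x + y) i = entry x i + entry y i. Proof. by []. Qed.
Lemma entryZ a x i : entry (a *: x) i = a * entry x i. Proof. by []. Qed.
Lemma entryN x i : entry (- x) i = - entry x i. Proof. by []. Qed.

Lemma entry_linear i : linear (fun x => entry x i : R^o).
Proof. by []. Qed.

Lemma entry_le x i : `|entry x i| <= `|x|.
Proof. exact: norm_scoord_le. Qed.

Lemma block_sum_le (l : seq (nat * (G * seq G))) (x : block_space) :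
  uniq (unzip1 l) -> \sum_(z <- l) block_test z.1 z.2 (entry x) <= `|x|.
Proof. by move=> ul; exact: (semi_le_norm (exist _ l ul : sd_tst block_data) x). Qed.

Lemma block_norm_le (x : block_space) M : 0 <= M ->
  (forall l, uniq (unzip1 l) -> \sum_(z <- l) block_test z.1 z.2 (entry x) <= M) ->
  `|x| <= M.
Proof.
by move=> M0 HM; apply: (@sup_norm_le R block_data) => // l; exact: HM (svalP l).
Qed.

Lemma block_test_le n b (x : block_space) : block_test n b (entry x) <= `|x|.
Proof. by have := @block_sum_le [:: (n, b)] x isT; rewrite big_seq1. Qed.

Lemma block_l1_le n s (x : block_space) : uniq s ->
  n.+1%:R^-1 * \sum_(g <- s) `|entry x (n, g)| <= `|x|.
Proof.
(* A test needs a base point, so the empty list is treated apart. *)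
case: s => [|g s] us; first by rewrite big_nil mulr0.
apply: le_trans (block_test_le n (g, g :: s) x).
by rewrite /block_test undup_id//= lerDr.
Qed.

Definition block_ind_fun n s (i : nat * G) : R^o := ((i.1 == n) && (i.2 \in s))%:R.

Lemma block_ind_test m n b s :
  block_test m b (block_ind_fun n s) <= (m == n)%:R * (1 + n.+1%:R^-1 * (size s)%:R).
Proof.
rewrite /block_test /block_ind_fun /=; case: eqP => [->|_] /=; last first.
  by rewrite mul0r normr0 big1 ?mulr0 ?addr0// => g _; rewrite normr0.
rewrite mul1r lerD//; first by rewrite normr_nat lern1 leq_b1.
rewrite ler_wpM2l ?invr_ge0//.
rewrite (eq_bigr (fun g => (g \in s)%:R)) => [|g _]; last by rewrite normr_nat.
rewrite -natr_sum ler_nat.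
have -> : (\sum_(g <- undup b.2) (g \in s) = size [seq g <- undup b.2 | g \in s])%N.
  by rewrite size_filter -sum1_count [RHS]big_mkcond.
apply: uniq_leq_size; first by rewrite filter_uniq ?undup_uniq.
by move=> g; rewrite mem_filter => /andP[].
Qed.

(** The keys are distinct, so at most one test meets block [n]. *)
Lemma block_ind_semi n s (l : seq (nat * (G * seq G))) : uniq (unzip1 l) ->
  \sum_(z <- l) block_test z.1 z.2 (block_ind_fun n s) <=
    1 + n.+1%:R^-1 * (size s)%:R.
Proof.
move=> ul; set c := 1 + _; have c0 : 0 <= c by rewrite addr_ge0// mulr_ge0 ?invr_ge0.
apply: le_trans (ler_sum _ (fun z _ => block_ind_test z.1 n z.2 s)) _.
rewrite -mulr_suml -/c ler_piMl// -natr_sum -(big_map fst predT (fun m => nat_of_bool (m == n))).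
have -> : (\sum_(m <- unzip1 l) (m == n) = count_mem n (unzip1 l))%N.
  by rewrite -sum1_count [RHS]big_mkcond.
by rewrite count_uniq_mem// lern1 leq_b1.
Qed.

Lemma block_ind_mem n s : sd_mem (s := block_data) (block_ind_fun n s).
Proof.
exists (1 + n.+1%:R^-1 * (size s)%:R) => l; exact: block_ind_semi (svalP l).
Qed.

Definition block_ind n s : block_space := exist _ _ (block_ind_mem n s).

Lemma entry_ind n s i : entry (block_ind n s) i = ((i.1 == n) && (i.2 \in s))%:R.
Proof. by []. Qed.

(** The weight of the [l_1] part is designed for this: [n + 1] unit vectors of block [n] have a sum
    of norm at most [1 + 1]. *)
Lemma block_ind_norm n s : (size s <= n.+1)%N -> `|block_ind n s| <= 2.
Proof.
move=> sn; apply: block_norm_le => // l ul; apply: le_trans (block_ind_semi n s ul) _.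
by rewrite -[2]/(1 + 1) lerD2l mulrC ler_pdivrMr// mul1r ler_nat.
Qed.

Lemma block_ind_sum n s : uniq s -> block_ind n s = \sum_(g <- s) block_ind n [:: g].
Proof.
elim: s => [_|g s IH /= /andP[gs us]].
  by rewrite big_nil; apply: sup_space_eq => i; rewrite -/(entry _ _) entry_ind andbF.
rewrite big_cons -IH//; apply: sup_space_eq => i.
rewrite -!/(entry _ _) entryD !entry_ind !in_cons in_nil orbF.
case: (i.1 == n); rewrite /= ?addr0//.
by have [->|_] := eqVneq i.2 g; rewrite /= ?(negbTE gs) ?addr0 ?add0r.
Qed.

End BlockSpace.

(** * The Schur property and nonseparability of the block space *)

Section BlockSchur.
Variables (R : realType) (G : eqType).
Notation E := (block_space R G).
Implicit Types (n : nat) (b : G * seq G) (g : G) (w y : E).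

Let norm_sg_le (a c : R) : `|Num.sg a * c| <= `|c|.
Proof. by rewrite normrM normr_sg ler_piMl// lern1 leq_b1. Qed.

(** Norming functionals made explicit by the signs of the entries of [w]; a single coordinate has
    only one test, whence the index type [unit]. *)
Let coord_hb n g (_ : unit) w y : R := n.+1%:R^-1 * (Num.sg (entry w (n, g)) * entry y (n, g)).

Let block_hb n b w y : R := Num.sg (entry w (n, b.1)) * entry y (n, b.1) +
  n.+1%:R^-1 * \sum_(g <- undup b.2) Num.sg (entry w (n, g)) * entry y (n, g).

Section Weak.
Variable x : nat -> E.
Hypothesis x_weak : weakly_cvg x 0.

Let entry_cvg0 i (e : R) : 0 < e -> \forall k \near \oo, `|entry (x k) i| <= e.
Proof.
move=> e0; pose f : {linear E -> R^o} := linear_fun (@entry_linear R G i).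
have bf : bounded_op f by exists 1 => y; rewrite mul1r; exact: entry_le.
have := x_weak bf; rewrite linear0 => /cvgrPdist_le/(_ _ e0).
by apply: filterS => k; rewrite sub0r normrN.
Qed.

(** The classical Schur argument for [l_1(G)], inside block [n]. *)
Let l1_cvg0 n (e : R) : 0 < e -> \forall k \near \oo, forall s, uniq s ->
  n.+1%:R^-1 * \sum_(g <- s) `|entry (x k) (n, g)| <= e.
Proof.
move=> e0.
have H := @gliding_hump R E G unit (fun g _ y => n.+1%:R^-1 * `|entry y (n, g)|)
  (coord_hb n) 1.
apply: filterS (H _ _ _ _ x x_weak _ e e0).
- move=> k Hk s us; have := Hk [seq (g, tt) | g <- s].
  rewrite /unzip1 -map_comp map_id => /(_ us).
  by rewrite big_map mulr_sumr.
- by move=> g u w a y z; rewrite /coord_hb entryD entryZ /=; rewrite /GRing.scale /=; ring.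
- by move=> g u w y; rewrite /coord_hb normrM ger0_norm ?invr_ge0// ler_wpM2l ?invr_ge0.
- by move=> g u w; rewrite /coord_hb -normrEsg.
- move=> l y ul; rewrite mul1r; apply: le_trans (block_l1_le n y ul).
  by rewrite mulr_sumr big_map.
- move=> g d d0; apply: filterS (entry_cvg0 (n, g) d0) => k Hk _.
  apply: le_trans Hk; rewrite ler_piMl// invf_le1 ?ler1n//.
Qed.

Let block_cvg0 n (e : R) : 0 < e ->
  \forall k \near \oo, forall b, block_test n b (entry (x k)) <= e.
Proof.
(* The extra factor cancels the weight when a single coordinate is tested, so that the sup part is
   also at most [e / 2]. *)
move=> e0; have e2 : 0 < n.+1%:R^-1 * (e / 2) by rewrite mulr_gt0 ?divr_gt0 ?invr_gt0.
apply: filterS (l1_cvg0 n e2) => k Hk b; rewrite /block_test [e]splitr.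
apply: lerD.
  have := Hk [:: b.1] isT; rewrite big_seq1 ler_pM2l ?invr_gt0//.
apply: le_trans (Hk _ (undup_uniq _)) _.
by rewrite ler_piMl ?invf_le1 ?ler1n// divr_ge0// ltW.
Qed.

Lemma block_weak_null_cvg0 : x n @[n --> \oo] --> 0.
Proof.
apply/cvgrPdist_le => e e0.
have H := @gliding_hump R E nat (G * seq G)%type (fun n b y => block_test n b (entry y))
  block_hb 1.
apply: filterS (H _ _ _ _ x x_weak block_cvg0 e e0).
- by move=> k Hk; rewrite sub0r normrN; apply: block_norm_le (ltW e0) _.
- move=> n b w a y z; rewrite /block_hb entryD entryZ /GRing.scale /=.
  rewrite (eq_bigr (fun g => a * (Num.sg (entry w (n, g)) * entry y (n, g)) +
     Num.sg (entry w (n, g)) * entry z (n, g))); last first.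
    by move=> g _; rewrite entryD entryZ; ring.
  by rewrite big_split /= -mulr_sumr; ring.
- move=> n b w y; rewrite /block_hb /block_test; apply: le_trans (ler_normD _ _) _.
  rewrite lerD// normrM ger0_norm ?invr_ge0// ler_wpM2l ?invr_ge0//.
  by apply: le_trans (ler_norm_sum _ _ _) _; apply: ler_sum.
- move=> n b w; rewrite /block_hb /block_test -normrEsg; congr (_ + _ * _).
  by apply: eq_bigr => g _; rewrite -normrEsg.
- by move=> l y ul; rewrite mul1r; exact: block_sum_le.
Qed.

End Weak.

Lemma block_schur : schur_property E.
Proof.
move=> x l xl; apply/subr_cvg0; apply: block_weak_null_cvg0 => f bf.
rewrite linear0 (_ : (fun n => _) = (fun n => f (x n) - f l)).
  by apply/subr_cvg0; exact: xl.
by apply/funext => n; rewrite linearB.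
Qed.

(** The unit vectors of block [0] are at mutual distance at least [1], so nearby points of a dense
    set are distinct for distinct [g] and inject [G] into it. *)
Lemma block_nonseparable : ~ countable [set: G] -> ~ separable E.
Proof.
move=> nG [D cD dD]; apply: nG.
have near_ind g : exists d, D d /\ `|block_ind R 0 [:: g] - d| < 2^-1.
  have h2 : (0 : R) < 2^-1 by rewrite invr_gt0.
  have [|d [Bd Dd]] := dD _ _ (ball_open (block_ind R 0 [:: g]) 2^-1).
    by exists (block_ind R 0 [:: g]); exact: ballxx.
  by exists d; split => //; move: Bd; rewrite -ball_normE.
have /choice[d Hd] := near_ind.
have d_inj g h : d g = d h -> g = h.
  move=> dgh; apply: contrapT => /eqP gh.
  have [_ Hg] := Hd g; have [_ Hh] := Hd h.
  have := entry_le (block_ind R 0 [:: g] - block_ind R 0 [:: h]) (0%N, g).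
  rewrite entryD entryN !entry_ind /= !inE !eqxx (negbTE gh) subr0 normr1.
  apply/negP; rewrite -ltNge; apply: le_lt_trans (ler_distD (d g) _ _) _.
  by rewrite [1]splitr mul1r; apply: ltrD => //; rewrite distrC dgh.
have /countable_injP[f finj] := cD.
apply/countable_injP; exists (f \o d) => g h _ _ /= fgh; apply: d_inj.
by apply: finj => //; rewrite inE; have [] := Hd g; have [] := Hd h.
Qed.

End BlockSchur.

(** * A quotient of Banach lattices *)

Section NullFamilies.
Variables (R : realType) (G : eqType).

Definition null_family (f : G -> R) : Prop :=
  forall e : R, 0 < e -> exists s : seq G, forall g, g \notin s -> `|f g| <= e.

Lemma null_family_scale (a : R) f : null_family f -> null_family (fun g => a * f g).
Proof.
move=> nf e e0; have a0 : 0 < `|a| + 1 by rewrite ltr_wpDl.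
have [s Hs] := nf _ (divr_gt0 e0 a0); exists s => g gs.
rewrite normrM; apply: (@le_trans _ _ ((`|a| + 1) * `|f g|)).
  by rewrite ler_wpM2r// lerDl.
by rewrite mulrC -ler_pdivlMr// Hs.
Qed.

Lemma null_family_le (F1 F2 f : G -> R) : null_family F1 -> null_family F2 ->
  (forall g, `|f g| <= `|F1 g| + `|F2 g|) -> null_family f.
Proof.
move=> n1 n2 H e e0; have e2 : 0 < e / 2 by rewrite divr_gt0.
have [s1 H1] := n1 _ e2; have [s2 H2] := n2 _ e2; exists (s1 ++ s2) => g.
rewrite mem_cat negb_or => /andP[g1 g2]; apply: le_trans (H g) _.
by rewrite [e]splitr lerD ?H1 ?H2.
Qed.

Lemma null_family_closed (f : G -> R) :
  (forall e, 0 < e -> exists2 h, null_family h & forall g, `|f g - h g| <= e) ->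
  null_family f.
Proof.
move=> H e e0; have e2 : 0 < e / 2 by rewrite divr_gt0.
have [h nh fh] := H _ e2; have [s Hs] := nh _ e2; exists s => g gs.
rewrite -[f g](subrK (h g)) [e]splitr; apply: le_trans (ler_normD _ _) _.
by rewrite lerD ?Hs.
Qed.

Lemma null_family_bounded (f : G -> R) : null_family f -> exists M, forall g, `|f g| <= M.
Proof.
move=> /(_ 1 ltr01)[s Hs]; exists (1 + \sum_(g <- s) `|f g|) => g.
have S0 : 0 <= \sum_(g <- s) `|f g| by rewrite sumr_ge0.
have [gs|/Hs H] := boolP (g \in s); last by apply: le_trans H _; rewrite lerDl.
rewrite (perm_big _ (perm_to_rem gs)) big_cons /= addrCA lerDl.
by rewrite addr_ge0// sumr_ge0.
Qed.

(** If a finite sum comes within [e] of the supremum, any further index adds at most [e]. *)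
Lemma summable_null_family (f : G -> R) (C : R) :
  (forall s, uniq s -> \sum_(g <- s) `|f g| <= C) -> null_family f.
Proof.
move=> HC e e0; pose S := [set r | exists2 s, uniq s & r = \sum_(g <- s) `|f g|].
have Sub : has_ubound S by exists C => _ [s us ->]; exact: HC.
have [||_ [s us ->] Hs] := @sup_gt _ S (sup S - e).
- by exists 0, [::]; rewrite ?big_nil.
- by rewrite ltrBlDr ltrDl.
exists s => g gs; have : \sum_(g <- g :: s) `|f g| <= sup S.
  by apply: ub_le_sup => //; exists (g :: s) => //=; rewrite gs.
by rewrite big_cons => H; move: Hs; lra.
Qed.

Let norm_max_le (a c : R) : `|Num.max a c| <= `|a| + `|c|.
Proof. by rewrite /Num.max; case: ifP => _; rewrite ?lerDl ?lerDr. Qed.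

Let mem (f : G -> R^o) := null_family f.

Let mem0 : mem (fun=> 0).
Proof. by move=> e e0; exists [::] => g _; rewrite normr0 ltW. Qed.

Let memD (f h : G -> R^o) : mem f -> mem h -> mem (fun g => f g + h g).
Proof. by move=> nf nh; apply: (null_family_le nf nh) => g; exact: (@ler_normD R R). Qed.

Let memJ (f h : G -> R^o) : mem f -> mem h -> mem (fun g => vjoin (f g) (h g)).
Proof. by move=> nf nh; apply: (null_family_le nf nh) => g; exact: norm_max_le. Qed.

Definition c0_data : lat_data R :=
  @LatData R G (fun=> R^o) mem mem0 memD (fun a f => @null_family_scale a f) memJ
    (fun f => @null_family_bounded f) (fun f => @null_family_closed f).

Definition c0_space := lat_space c0_data.
HB.instance Definition _ := BanachLattice.copy c0_space (lat_space c0_data).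

End NullFamilies.

(** * Functions on the binary tree and their boundary values *)

Section TreeSpace.
Variable R : realType.
Notation G := (nat -> bool).
Notation node := (seq bool + G)%type.
Implicit Types (g h : G) (f : node -> R).

(** [inl] marks finite words, the nodes proper, and [inr] marks branches; [mkseq g n] is the node of
    the branch [g] at level [n]. *)
Definition branch_cvg (f : node -> R) : Prop :=
  forall g (e : R), 0 < e -> exists N, forall n, (N <= n)%N ->
    `|f (inl (mkseq g n)) - f (inr g)| <= e.

Definition tree_mem f : Prop :=
  [/\ exists M, forall s, `|f (inl s)| <= M, null_family (f \o inr) & branch_cvg f].

Lemma branch_cvg_le (F1 F2 f : node -> R) : branch_cvg F1 -> branch_cvg F2 ->
  (forall i j, `|f i - f j| <= `|F1 i - F1 j| + `|F2 i - F2 j|) -> branch_cvg f.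
Proof.
move=> b1 b2 H g e e0; have e2 : 0 < e / 2 by rewrite divr_gt0.
have [N1 H1] := b1 g _ e2; have [N2 H2] := b2 g _ e2.
exists (maxn N1 N2) => n; rewrite geq_max => /andP[n1 n2].
by apply: le_trans (H _ _) _; rewrite [e]splitr lerD ?H1 ?H2.
Qed.

(** Covers sums, joins and truncations together; the estimate on differences is what transfers
    convergence along branches. *)
Lemma tree_mem_le (F1 F2 f : node -> R) : tree_mem F1 -> tree_mem F2 ->
  (forall i, `|f i| <= `|F1 i| + `|F2 i|) ->
  (forall i j, `|f i - f j| <= `|F1 i - F1 j| + `|F2 i - F2 j|) -> tree_mem f.
Proof.
move=> [[M HM] n1 b1] [[K HK] n2 b2] H1 H2; split.
- by exists (M + K) => s; apply: le_trans (H1 _) _; rewrite lerD.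
- by apply: (null_family_le n1 n2) => g; exact: H1.
- exact: branch_cvg_le H2.
Qed.

Lemma tree_mem0 : tree_mem (fun=> 0).
Proof.
split; first by exists 0 => s; rewrite normr0.
- by move=> e e0; exists [::] => g _ /=; rewrite normr0 ltW.
- by move=> g e e0; exists 0%N => n _; rewrite subrr normr0 ltW.
Qed.

Lemma tree_memZ (a : R) f : tree_mem f -> tree_mem (fun i => a * f i).
Proof.
move=> [[M HM] nf bf]; split.
- by exists (`|a| * M) => s; rewrite normrM ler_wpM2l.
- exact: (null_family_scale a nf).
- move=> g e e0; have a0 : 0 < `|a| + 1 by rewrite ltr_wpDl.
  have [N HN] := bf g _ (divr_gt0 e0 a0); exists N => n Nn.
  rewrite -mulrBr normrM; apply: (@le_trans _ _ ((`|a| + 1) * (e / (`|a| + 1)))).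
    by apply: ler_pM; rewrite ?lerDl//; exact: HN.
  by rewrite mulrCA mulfV ?mulr1// gt_eqF.
Qed.

Lemma tree_bounded f : tree_mem f -> exists M, forall i, `|f i| <= M.
Proof.
move=> [[M HM] /null_family_bounded[K HK] _]; exists (Num.max M K) => -[s|g].
  by rewrite le_max HM.
by rewrite le_max orbC; have /= -> := HK g.
Qed.

Lemma tree_closed f :
  (forall e, 0 < e -> exists2 h, tree_mem h & forall i, `|f i - h i| <= e) -> tree_mem f.
Proof.
move=> H; split.
- have [h [[M HM] _ _] fh] := H _ ltr01; exists (1 + M) => s.
  by rewrite -[f _](subrK (h (inl s))); apply: le_trans (ler_normD _ _) _; rewrite lerD.
- apply: null_family_closed => e e0; have [h [_ nh _] fh] := H _ e0.
  by exists (h \o inr) => // g; exact: fh.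
- move=> g e e0; have e3 : 0 < e / 3 by rewrite divr_gt0.
  have [h [_ _ bh] fh] := H _ e3; have [N HN] := bh g _ e3; exists N => n Nn.
  have := HN _ Nn; have := fh (inl (mkseq g n)); have := fh (inr g).
  by rewrite !ler_norml => /andP[? ?] /andP[? ?] /andP[? ?]; apply/andP; split; lra.
Qed.

Let memD (f1 f2 : node -> R^o) :
  tree_mem f1 -> tree_mem f2 -> tree_mem (fun i => f1 i + f2 i).
Proof.
move=> t1 t2; apply: (tree_mem_le t1 t2) => [i|i j]; first exact: (@ler_normD R R).
by rewrite opprD addrACA; exact: (@ler_normD R R).
Qed.

Let memJ (f1 f2 : node -> R^o) :
  tree_mem f1 -> tree_mem f2 -> tree_mem (fun i => vjoin (f1 i) (f2 i)).
Proof.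
move=> t1 t2; apply: (tree_mem_le t1 t2) => [i|i j].
  exact: (@norm_vjoin_le R R^o).
exact: (@norm_vjoin_sub R R^o).
Qed.

Definition tree_data : lat_data R :=
  @LatData R node (fun=> R^o) tree_mem tree_mem0 memD (fun a f => @tree_memZ a f)
    memJ (fun f => @tree_bounded f) (fun f => @tree_closed f).

Definition tree_space := lat_space tree_data.
HB.instance Definition _ := BanachLattice.copy tree_space (lat_space tree_data).

Notation Z := (c0_space R G).

Definition boundary_fun (x : tree_space) : Z :=
  exist _ (fun g => lcoord x (inr g)) (let: And3 _ nx _ := svalP x in nx).

Lemma boundary_linear : linear boundary_fun.
Proof. by move=> a x y; apply: lat_space_eq. Qed.

Definition boundary : {linear tree_space -> Z} := linear_fun boundary_linear.

Lemma boundaryE x g : lcoord (boundary x) g = lcoord x (inr g).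
Proof. by []. Qed.

Lemma boundary_le x : `|boundary x| <= `|x|.
Proof. by apply: lat_norm_le => // g; rewrite boundaryE; exact: norm_lcoord_le. Qed.

Lemma boundary_hom : blat_hom boundary.
Proof.
split; last 2 first.
- by move=> x y; apply: lat_space_eq.
- by move=> x y; apply: lat_space_eq.
by exists 1 => x; rewrite mul1r boundary_le.
Qed.

Definition boundary_ker : set tree_space := [set x | boundary x = 0].

Lemma boundary_kerP x : boundary_ker x <-> forall g, lcoord x (inr g) = 0 :> R^o.
Proof.
split => [x0 g|x0]; first by rewrite -boundaryE x0.
by apply: lat_space_eq => g; rewrite boundaryE x0.
Qed.

Lemma boundary_ker_ideal : closed_ideal boundary_ker.
Proof.
split.
- move=> x clx; apply/eqP; rewrite -normr_le0; apply/ler_addgt0Pr => e e0.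
  have [y [y0 xy]] := clx _ (nbhsx_ballx x _ e0).
  rewrite add0r -[boundary x]subr0 -y0 -linearB; apply: le_trans (boundary_le _) _.
  by move: xy; rewrite -ball_normE => /ltW.
- exact: linear0.
- move=> a x y x0 y0; change (boundary (a *: x + y) = 0).
  by rewrite linearP (x0 : boundary x = 0) (y0 : boundary y = 0) scaler0 addr0.
- move=> x y /boundary_kerP y0 /vle_lcoord xy; apply/boundary_kerP => g.
  have := xy (inr g); rewrite !lcoordJ !lcoordN y0 oppr0.
  have -> : vjoin 0 0 = 0 :> R^o by exact: maxxx.
  have -> : vjoin (lcoord x (inr g)) (- lcoord x (inr g)) = `|lcoord x (inr g) : R| :> R^o.
    exact: maxrN.
  by move=> H; apply/eqP; rewrite -normr_le0.
Qed.

(** Truncation to [[-M, M]], used to find a representative of least norm in a coset of the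
    kernel. *)
Definition clip (M v : R) : R := Num.max (- M) (Num.min M v).

Lemma clip_lipschitz M v w : `|clip M v - clip M w| <= `|v - w|.
Proof.
rewrite /clip /Num.max /Num.min.
have := ler_norm (v - w); have := ler_norm (w - v); rewrite (distrC w v) => h1 h2.
case: (ltP M v) => ?; case: (ltP M w) => ?; do 2?[case: (ltP (- M) _) => ?]; rewrite ler_norml; apply/andP; split; lra.
Qed.

Lemma clip_le M v : 0 <= M -> `|clip M v| <= M.
Proof.
move=> M0; rewrite /clip /Num.max /Num.min.
by case: (ltP M v) => ?; case: (ltP (- M) _) => ?; rewrite ler_norml; apply/andP; split; lra.
Qed.

Lemma clip_id M v : `|v| <= M -> clip M v = v.
Proof.
rewrite ler_norml => /andP[h1 h2]; rewrite /clip /Num.max /Num.min.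
by case: (ltP M v) => ?; case: (ltP (- M) _) => ?; lra.
Qed.

Lemma clip_mem M (x : tree_space) : 0 <= M -> tree_mem (fun i => clip M (lcoord x i)).
Proof.
move=> M0; apply: (tree_mem_le (svalP x) tree_mem0) => [i|i j]; last first.
  by rewrite subrr normr0 addr0; exact: clip_lipschitz.
rewrite normr0 addr0; have := clip_lipschitz M (lcoord x i) 0.
by rewrite (@clip_id M 0) ?normr0// !subr0.
Qed.

(** One inequality is contractivity. For the other, truncating [x] at the level of its boundary norm
    keeps the boundary values, so it changes [x] by an element of the kernel. *)
Lemma boundary_norm x : `|boundary x| = inf [set `|x - j| | j in boundary_ker].
Proof.
set S := [set _ | _ in _].
have S0 : S !=set0 by exists `|x - 0|; exists 0 => //; exact: linear0.
apply/le_anti/andP; split.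
  apply: lb_le_inf => // _ [j j0 <-]; apply: le_trans (boundary_le _).
  by rewrite linearB (j0 : boundary j = 0) subr0.
pose y : tree_space := exist _ _ (clip_mem x (normr_ge0 (boundary x))).
have yE i : lcoord y i = clip `|boundary x| (lcoord x i) by [].
apply: (@le_trans _ _ `|y|); last first.
  by apply: lat_norm_le => // i; rewrite yE; exact: clip_le.
apply: ge_inf; first by exists 0 => _ [j _ <-]; exact: normr_ge0.
exists (x - y); last by rewrite subKr.
apply/boundary_kerP => g; rewrite lcoordD lcoordN yE clip_id ?subrr//.
by rewrite -boundaryE; exact: norm_lcoord_le.
Qed.

Definition cone (s : seq bool) : set G := [set g | mkseq g (size s) = s].

Definition cone_sup (z : G -> R) (s : seq bool) : R := sup (z @` cone s).

Lemma cone_mkseq g n : cone (mkseq g n) g.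
Proof. by rewrite /cone /= size_mkseq. Qed.

Lemma cone_nonempty s : cone s !=set0.
Proof. by exists (nth false s); rewrite /cone /= mkseq_nth. Qed.

(** Finitely many branches other than [g] have all parted from [g] below some level. *)
Lemma separating_level g (L : seq G) : exists N, forall n h, (N <= n)%N -> h \in L ->
  mkseq h n = mkseq g n -> h = g.
Proof.
elim: L => [|h0 L [N HN]]; first by exists 0%N.
have [h0g|h0g] := pselect (h0 = g).
  exists N => n h Nn; rewrite in_cons => /orP[/eqP -> //|]; exact: HN.
have [i hi] : exists i, h0 i <> g i.
  by apply: contrapT => H; apply: h0g; apply/funext => i; apply: contrapT => hi; apply: H; exists i.
exists (maxn N i.+1) => n h; rewrite geq_max => /andP[Nn ni].
rewrite in_cons => /orP[/eqP -> /(congr1 (nth false ^~ i))|]; last exact: HN.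
by rewrite !nth_mkseq.
Qed.

(** Outside a finite set of branches [z] is at most [e], and far along [g] the cone meets that set
    at most in [g]. The supremum over the cone then lies between [z g] and [z g + e]. *)
Lemma cone_sup_tree (z : G -> R) : null_family z -> (forall g, 0 <= z g) ->
  tree_mem (fun i => match i with inl s => cone_sup z s | inr g => z g end).
Proof.
move=> nz z0; have [M HM] := null_family_bounded nz.
have zM g : z g <= M by apply: le_trans (HM g); exact: ler_norm.
have Sub s : has_ubound (z @` cone s) by exists M => _ [g _ <-].
split => //.
- exists M => s; have [g gs] := cone_nonempty s.
  rewrite ger0_norm.
    by apply: ge_sup; [exists (z g), g|move=> _ [h _ <-]].
  by apply: le_trans (z0 g) _; apply: ub_le_sup => //; exists g.
- move=> g e e0; have [L HL] := nz _ e0; have [N HN] := separating_level g L.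
  exists N => n Nn; rewrite ger0_norm ?subr_ge0; last first.
    by apply: ub_le_sup => //; exists g => //; exact: cone_mkseq.
  rewrite lerBlDr; apply: ge_sup; first by exists (z g), g => //; exact: cone_mkseq.
  move=> _ [h hn <-]; have [hL|hL] := boolP (h \in L).
    rewrite (HN n h Nn hL) ?lerDr ?ltW//.
    by move: hn; rewrite /cone /= size_mkseq.
  by apply: le_trans (ler_norm _) _; apply: le_trans (HL _ hL) _; rewrite lerDl.
Qed.

Let max_sub_max0 (v : R) : Num.max v 0 - Num.max (- v) 0 = v.
Proof. by case: (ltP v 0) => ?; case: (ltP (- v) 0) => ?; lra. Qed.

Lemma boundary_surj (z : Z) : exists x, boundary x = z.
Proof.
(* [cone_sup_tree] asks for nonnegative values; [c = 1] and [c = -1] give the positive and negative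
   parts of [z]. *)
have part (c : R) : null_family (fun g => Num.max (c * lcoord z g) 0).
  apply: (@null_family_le _ _ (fun g => c * lcoord z g) (fun g => 0 * lcoord z g)).
  - exact: (null_family_scale c (svalP z)).
  - exact: (null_family_scale 0 (svalP z)).
  - by move=> g; rewrite mul0r normr0 addr0 /Num.max; case: ifP => //; rewrite normr0.
have part0 (c : R) g : 0 <= Num.max (c * lcoord z g) 0 by rewrite le_max lexx orbT.
pose y (c : R) : tree_space := exist _ _ (cone_sup_tree (part c) (part0 c)).
exists (y 1 - y (-1)); apply: lat_space_eq => g.
rewrite boundaryE lcoordD lcoordN.
have yE c : lcoord (y c) (inr g) = Num.max (c * lcoord z g) 0 by [].
by rewrite !yE mul1r mulN1r; exact: max_sub_max0.
Qed.

Lemma boundary_quotient : quotient_map boundary_ker boundary.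
Proof.
split; [exact: boundary_hom|exact: boundary_surj| |exact: boundary_norm].
by [].
Qed.

End TreeSpace.

(** * Non-projectivity *)

Section Entries.
Variables (R : realType) (G : eqType) (n : nat).
Notation E := (block_space R G).

(** Up to the factor [n + 1] the norm bounds the [l_1]-norm of block [n], and summable families are
    null. *)
Lemma entries_null (x : E) : null_family (fun g => entry x (n, g)).
Proof.
apply: (@summable_null_family _ _ _ (n.+1%:R * `|x|)) => s us.
by rewrite -ler_pdivrMl ?ltr0n//; exact: block_l1_le.
Qed.

Definition entries_fun (x : E) : c0_space R G := exist _ _ (entries_null x).

Lemma entries_linear : linear entries_fun.
Proof. by move=> a x y; apply: lat_space_eq. Qed.

Definition entries : {linear E -> c0_space R G} := linear_fun entries_linear.

Lemma entriesE x g : lcoord (entries x) g = entry x (n, g).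
Proof. by []. Qed.

Lemma entries_le x : `|entries x| <= `|x|.
Proof. by apply: lat_norm_le => // g; rewrite entriesE; exact: entry_le. Qed.

End Entries.

Lemma uncountable_branches : ~ countable [set: nat -> bool].
Proof.
move=> /countable_injP[f finj].
(* Cantor's diagonal branch. The default [true] does not matter, since [d] is only evaluated at
   [f d], which is in the range of [f]. *)
pose d n := if pselect (exists g, f g = n) is left ex then ~~ projT1 (cid ex) n else true.
have dE : d (f d) = ~~ d (f d).
  rewrite {1}/d; case: pselect => [ex|]; last by case; exists d.
  by case: (cid ex) => g /= /finj ->; rewrite ?inE.
by case: (d (f d)) dE.
Qed.

(** Otherwise all fibres are finite, and [G] is a countable union of finite sets. *)
Lemma uncountable_fiber (G : choiceType) (C : countType) (f : G -> C) (n : nat) :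
  ~ countable [set: G] ->
  exists c, exists s : seq G, [/\ uniq s, size s = n & forall g, g \in s -> f g = c].
Proof.
move=> uG; apply: contrapT => H; apply: uG.
have -> : [set: G] = \bigcup_(c in [set: C]) (f @^-1` [set c]).
  by apply/seteqP; split => // g _; exists (f g).
apply: bigcup_countable => // c _; apply: finite_set_countable.
apply: contrapT => /(infinite_set_fset n)[B Bc nB]; apply: H.
exists c, (take n (finmap.enum_fset B)); split.
- by rewrite take_uniq.
- by rewrite size_takel.
- by move=> g /mem_take gB; exact: Bc.
Qed.

Lemma fbl_not_projective (R : realType) :
  ~ infty_projective (fbl (block_space R (nat -> bool))).
Proof.
have half (v : R) : `|v - 1| <= 2^-1 -> 2^-1 <= v.
  by rewrite ler_norml => /andP[? _]; lra.
have contra_bounds (a b : R) : 4 * a < b -> b * 2^-1 <= a * 2 -> False by lra.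
set G := nat -> bool; set E := block_space R G; set F := fbl E.
move=> [lambda l1 Hproj]; have l0 : 0 <= lambda by rewrite (le_trans ler01)// ltW.
(* Chosen so that the lower bound [(n + 1) / 2] at the common node exceeds the upper bound
   [2 * lambda]. *)
have [n nl] : exists n : nat, 4 * lambda < n.+1%:R.
  by exists (Num.truncn (4 * lambda)); rewrite truncnS_gt.
have bT : bounded_op (entries R G n) by exists 1 => x; rewrite mul1r; exact: entries_le.
have [_ /(_ _ _ bT)[S [Shom ST Snorm] _]] := fbl_is_FBL E.
have [That [[bThat _ _] ThatS Thatle]] :=
  Hproj _ _ (boundary_ker_ideal R) _ _ (boundary_quotient R) S Shom.
have Tl y : `|That y| <= lambda * `|y|.
  apply: le_trans (le_opnorm bThat _) _; rewrite ler_wpM2r//.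
  apply: le_trans Thatle _; rewrite Snorm ler_piMr//.
  by apply: opnorm_le => // x; rewrite mul1r; exact: entries_le.
pose e (g : G) : E := block_ind R n [:: g].
pose f g := That (fbl_gen E (e g)).
have fg g : lcoord (f g) (inr g) = 1 :> R.
  by rewrite -boundaryE -ThatS ST entriesE entry_ind /= eqxx inE eqxx.
(* The lift of [e g] has the value [1] at the branch [g], so by convergence it is at least [1 / 2]
   at some node of that branch. *)
have /choice[s Hs] g : exists s : seq bool, (2^-1 : R) <= lcoord (f g) (inl s).
  have h2 : (0 : R) < 2^-1 by rewrite invr_gt0.
  have bf : branch_cvg (lcoord (f g)) by have [] := svalP (f g).
  have [N /(_ N (leqnn N))] := bf g _ h2.
  by rewrite fg => /half; exists (mkseq g N).
have [c [l [ul nl' lc]]] := uncountable_fiber s n.+1 uncountable_branches.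
have xE : That (fbl_gen E (block_ind R n l)) = \sum_(g <- l) f g.
  by rewrite (block_ind_sum R n ul) !raddf_sum.
have up : lcoord (That (fbl_gen E (block_ind R n l))) (inl c) <= lambda * 2 :> R.
  apply: le_trans (ler_norm _) _; apply: le_trans (norm_lcoord_le _ _) _.
  apply: le_trans (Tl _) _; rewrite ler_wpM2l//.
  by apply: le_trans (fbl_gen_le _) _; apply: block_ind_norm; rewrite nl'.
(* All [n + 1] branches in [l] were assigned the same node [c], so their contributions of at least
   [1 / 2] add up there. *)
have low : n.+1%:R * 2^-1 <= lcoord (\sum_(g <- l) f g) (inl c) :> R.
  rewrite -nl'; elim: (l) lc => [|g l' IH] lc.
    by rewrite mul0r big_nil.
  rewrite big_cons lcoordD /= -natr1 mulrDl mul1r addrC lerD//.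
    by rewrite -(lc g) ?mem_head.
  by apply: IH => h hl; apply: lc; rewrite in_cons hl orbT.
by move: up; rewrite xE => /(le_trans low); exact: contra_bounds nl.
Qed.

Theorem mainTheorem4 (R : realType) :
  exists E : completeNormedModType R,
    [/\ ~ separable E,
        schur_property E &
        exists (F : banachLatticeType R) (u : {linear E -> F}),
          is_FBL u /\ ~ infty_projective F].
Proof.
exists (block_space R (nat -> bool)); split.
- exact: block_nonseparable uncountable_branches.
- exact: block_schur.
- exists (fbl (block_space R (nat -> bool))), (fbl_gen _).
  by split; [exact: fbl_is_FBL|exact: fbl_not_projective].
Qed.
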